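(* Let $\nu>-1$ be real, let $j_{\nu+1,n}$ ($n\ge1$) be the positive zeros of the Bessel function $J_{\nu+1}$, and put $G_\nu(s)=W_\nu(\sqrt s)$ for $s>0$, where $W_\nu(z)=\dfrac{zI_\nu(z)}{I_{\nu+1}(z)}$ for $z>0$. Then for all $s>0$ $$G_\nu(s)=2(\nu+1)+2\sum_{n=1}^{\infty}\frac{s}{s+j_{\nu+1,n}^2},\qquad G_\nu'(s)=2\sum_{n=1}^{\infty}\frac{j_{\nu+1,n}^2}{(s+j_{\nu+1,n}^2)^2}.$$ Consequently $G_\nu$ is a Bernstein function on $(0,\infty)$.
   Context: $I_\mu$ is the modified Bessel function of the first kind of order $\mu>-1$: for $z>0$, $I_\mu(z)=\sum_{k\ge0}\frac{(z/2)^{2k+\mu}}{k!\,\Gamma(k+\mu+1)}$. $J_\mu$ is the ordinary Bessel function of the first kind of order $\mu$, and $j_{\mu,n}$ is its $n$-th positive zero. A function $f:(0,\infty)\to[0,\infty)$ is completely monotone if $f\in C^\infty$ and $(-1)^nf^{(n)}(x)\ge0$ for all integers $n\ge0$ and all $x>0$. A function $g:(0,\infty)\to[0,\infty)$ is a Bernstein function if $g\in C^\infty$ and $g'$ is completely monotone. *)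

(* Defs.v *)
From Stdlib Require Import Reals Factorial List ClassicalEpsilon.
From Coquelicot Require Import Coquelicot.

Open Scope R_scope.

(* Euler's integral; it converges, and so is meaningful, for x > 0 only. *)
Definition Gamma (x : R) : R :=
  RInt_gen (fun t => Rpower t (x - 1) * exp (- t))
    (at_right 0) (Rbar_locally p_infty).

(* Both Bessel functions are meant for mu > -1 and z > 0: then every Gamma
   argument is positive and Rpower is the usual real power of z / 2. *)
Definition bessel_I (mu z : R) : R :=
  Series (fun k => Rpower (z / 2) (2 * INR k + mu)
                   / (INR (fact k) * Gamma (INR k + mu + 1))).

Definition bessel_J (mu z : R) : R :=
  Series (fun k => (-1) ^ k * Rpower (z / 2) (2 * INR k + mu)
                   / (INR (fact k) * Gamma (INR k + mu + 1))).

(* z is a positive zero of f and f has exactly n - 1 zeros in (0, z), listed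
   by l; no z satisfies this for n = 0. *)
Definition is_nth_positive_zero (f : R -> R) (n : nat) (z : R) : Prop :=
  0 < z /\ f z = 0 /\
  exists l : list R,
    NoDup l /\ S (length l) = n /\
    forall w : R, In w l <-> (0 < w < z /\ f w = 0).

(* The point is unique when it exists, so epsilon makes no arbitrary choice
   between zeros; zeros are numbered from 1. *)
Definition bessel_J_zero (mu : R) (n : nat) : R :=
  epsilon (inhabits 0) (is_nth_positive_zero (bessel_J mu) n).

(* Functions on (0, oo) are total functions whose values at x <= 0 are
   ignored; derivatives at x > 0 do not depend on them. *)
Definition smooth_pos (f : R -> R) : Prop :=
  forall (n : nat) (x : R), 0 < x -> ex_derive_n f n x.

Definition completely_monotone (f : R -> R) : Prop :=
  smooth_pos f /\
  forall (n : nat) (x : R), 0 < x -> 0 <= (-1) ^ n * Derive_n f n x.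

Definition Bernstein (g : R -> R) : Prop :=
  (forall x : R, 0 < x -> 0 <= g x) /\
  smooth_pos g /\
  completely_monotone (Derive g).

Definition W (nu z : R) : R := z * bessel_I nu z / bessel_I (nu + 1) z.

Definition G (nu s : R) : R := W nu (sqrt s).

(* Main.v *)
Require Import Defs.
From Stdlib Require Import Reals Factorial Lra Lia List Permutation Classical ClassicalEpsilon.
From Coquelicot Require Import Coquelicot.
Open Scope R_scope.

(** Write mu = nu + 1 and let bfun mu be the entire function
      F(x) = sum_k x^k / (k! (mu + 1) ... (mu + k)),
    so that, up to factors that do not vanish for z > 0, I_mu(z) is F(z^2/4) and J_mu(z) is
    F(-z^2/4). The contiguity relation between the series of parameters nu and
    nu + 1 gives G_nu(s) = 2 (nu + 1) + 2 x F'(x)/F(x) at x = s/4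
    ([G_bfun]). Everything therefore rests on the partial fraction expansion
      F'(x)/F(x) = sum_n 1/(x + z_n)   for x > 0,
    where the z_n = j_n^2/4 are the zeros of t |-> F(-t)
    ([bfun_log_derivative_series]). Hadamard's theorem together with the reality
    of the zeros of J_mu would give it; the proof below stays on the real line
    and obtains both facts at once from polynomials with only real zeros.

    The rescaled Laguerre polynomials P_n converge to F, with their derivatives,
    uniformly on bounded sets ([bfun_approx_cvg]), and t |-> P_n(-t) has n
    distinct positive zeros r ([laguerre_roots], by alternation of signs).
    Being of degree n, P_n satisfies exactly P_n'/P_n (x) = sum_r 1/(r + x), and
    in particular sum_r 1/r = P_n'(0) = 1/(mu + 1) for every n. The zeros of
    F(-t) are simple by the differential equation ([bfun_simple_zeros]), so the
    zeros of P_n below a bound M converge one by one to those of F, as in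
    Hurwitz's theorem ([zeros_cvg_global]). In
      1/(mu + 1) - P_n'/P_n (x) = sum_r (1/r - 1/(r + x))
    the zeros above M contribute at most x/M * 1/(mu + 1), because the terms are
    at most (x/M) (1/r). Passing to the limit in n and then in M gives
      1/(mu + 1) - F'/F (x) = sum_n (1/z_n - 1/(z_n + x)),
    that is, F'/F (x) = beta + sum_n 1/(z_n + x) with a constant beta >= 0, which
    could come from zeros of P_n escaping to infinity. But beta <= F'/F (x), and
    x F'^2 <= F^2 for x > 0 by an energy argument, so F'/F tends to 0 and
    beta = 0. The same reasoning with finitely many zeros would contradict the
    Riccati equation of F'/F, so there are infinitely many
    ([bfun_zeros_unbounded]).

    Since sum 1/z_n converges, the expansion of G_nu may be differentiated term
    by term any number of times; the successive derivatives of s/(s + b) have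
    alternating signs, which is the Bernstein property. *)

(** * Euler's integral for the Gamma function *)

Lemma exp_monotone x y : x <= y -> exp x <= exp y.
Proof. intros [H| ->]; [left; apply exp_increasing, H|right; reflexivity]. Qed.

Definition gamma_integrand (x t : R) : R := Rpower t (x - 1) * exp (- t).

Lemma gamma_integrand_pos x t : 0 < gamma_integrand x t.
Proof. apply Rmult_lt_0_compat; apply exp_pos. Qed.

Lemma gamma_integrand_continuous x t : 0 < t -> continuous (gamma_integrand x) t.
Proof.
  intros Ht; apply (ex_derive_continuous (V := R_NormedModule)).
  unfold gamma_integrand, Rpower; auto_derive; lra.
Qed.

Lemma ex_RInt_gamma_integrand x a b :
  0 < a -> 0 < b -> ex_RInt (gamma_integrand x) a b.
Proof.
  intros Ha Hb; apply (ex_RInt_continuous (V := R_CompleteNormedModule)).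
  intros t [Ht _]; apply gamma_integrand_continuous.
  unfold Rmin in Ht; destruct (Rle_dec a b); lra.
Qed.

Lemma RInt_le_antiderivative (g h H : R -> R) (a b : R) :
  a <= b -> ex_RInt g a b ->
  (forall t, a <= t <= b -> is_derive H t (h t)) ->
  (forall t, a <= t <= b -> continuous h t) ->
  (forall t, a < t < b -> g t <= h t) ->
  RInt g a b <= H b - H a.
Proof.
  intros Hab Hg HH Hh Hle.
  assert (Hint : is_RInt h a b (H b - H a)).
  { apply (is_RInt_derive (V := R_CompleteNormedModule) H h);
      rewrite Rmin_left, Rmax_right by lra; auto. }
  rewrite <- (is_RInt_unique _ _ _ _ Hint).
  apply RInt_le; auto; eexists; exact Hint.
Qed.

Lemma RInt_gamma_integrand_near_0 x a :
  0 < x -> 0 < a <= 1 -> RInt (gamma_integrand x) a 1 <= / x.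
Proof.
  intros Hx Ha.
  apply Rle_trans with (Rpower 1 x / x - Rpower a x / x).
  - apply (RInt_le_antiderivative _ (fun t => Rpower t (x - 1)) (fun t => Rpower t x / x)).
    + lra.
    + apply ex_RInt_gamma_integrand; lra.
    + intros t Ht; unfold Rpower; auto_derive; [lra|].
      replace ((x - 1) * ln t) with (x * ln t + - ln t) by ring.
      rewrite exp_plus, exp_Ropp, exp_ln by lra; field; lra.
    + intros t Ht; apply (ex_derive_continuous (V := R_NormedModule)).
      unfold Rpower; auto_derive; lra.
    + intros t Ht; unfold gamma_integrand.
      rewrite <- (Rmult_1_r (Rpower t (x - 1))) at 2.
      apply Rmult_le_compat_l; [left; apply exp_pos|].
      rewrite <- exp_0; left; apply exp_increasing; lra.
  - assert (H1 : 0 < Rpower a x / x) by (apply Rdiv_lt_0_compat; [apply exp_pos|lra]).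
    unfold Rpower at 1; rewrite ln_1, Rmult_0_r, exp_0; lra.
Qed.

(** The integrand is dominated by C exp(-t/2): with m = |x - 1| and
    k = 2 (m + 1), the bound ln t <= t/k + ln k makes m ln t at most
    t/2 + m ln k. *)
Lemma RInt_gamma_integrand_near_infty x :
  exists B, forall b, 1 <= b -> RInt (gamma_integrand x) 1 b <= B.
Proof.
  set (m := Rabs (x - 1)); set (k := 2 * (m + 1)).
  assert (Hm : 0 <= m) by apply Rabs_pos.
  set (C := exp (m * ln k)).
  exists (2 * C); intros b Hb.
  apply Rle_trans with (-2 * C * exp (- (b / 2)) - -2 * C * exp (- (1 / 2))).
  - apply (RInt_le_antiderivative _ (fun t => C * exp (- (t / 2)))
             (fun t => -2 * C * exp (- (t / 2)))).
    + lra.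
    + apply ex_RInt_gamma_integrand; lra.
    + intros t Ht; auto_derive; [trivial|unfold Rdiv; lra].
    + intros t Ht; apply (ex_derive_continuous (V := R_NormedModule)).
      auto_derive; trivial.
    + intros t Ht; unfold gamma_integrand, Rpower, C.
      rewrite <- !exp_plus; apply exp_monotone.
      (* ln t <= t / k + ln k, by ln y <= y at y = t / k *)
      assert (Hln : ln t <= t / k + ln k).
      { replace t with (t / k * k) at 1 by (unfold k; field; lra).
        assert (0 < t / k) by (apply Rdiv_lt_0_compat; unfold k; lra).
        rewrite ln_mult by (unfold k in *; lra).
        assert (ln (t / k) < t / k); [|lra].
        apply exp_lt_inv; rewrite exp_ln by lra.
        generalize (exp_ineq1 (t / k)); lra. }
      assert (H0 : 0 <= ln t) by (rewrite <- ln_1; apply ln_le; lra).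
      assert (H1 : (x - 1) * ln t <= m * (t / k + ln k)).
      { apply Rle_trans with (m * ln t).
        - apply Rmult_le_compat_r; [lra|apply Rle_abs].
        - apply Rmult_le_compat_l; lra. }
      assert (H2 : m * (t / k) <= t / 2).
      { replace (m * (t / k)) with (t / 2 - t / k) by (unfold k; field; lra).
        assert (0 < t / k) by (apply Rdiv_lt_0_compat; unfold k; lra). lra. }
      lra.
  - assert (HC : 0 < C) by apply exp_pos.
    assert (H1 : 0 < exp (- (b / 2))) by apply exp_pos.
    assert (H2 : exp (- (1 / 2)) < 1) by (rewrite <- exp_0 at 2; apply exp_increasing; lra).
    nra.
Qed.

Lemma RInt_gamma_integrand_incr x a' a b b' :
  0 < a' <= a -> a <= b <= b' ->
  RInt (gamma_integrand x) a b <= RInt (gamma_integrand x) a' b'.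
Proof.
  intros Ha Hb.
  rewrite <- (RInt_Chasles (gamma_integrand x) a' a b'),
    <- (RInt_Chasles (gamma_integrand x) a b b')
    by (apply ex_RInt_gamma_integrand; lra).
  assert (H1 : 0 <= RInt (gamma_integrand x) a' a).
  { apply RInt_ge_0; [lra|apply ex_RInt_gamma_integrand; lra|].
    intros; left; apply gamma_integrand_pos. }
  assert (H2 : 0 <= RInt (gamma_integrand x) b b').
  { apply RInt_ge_0; [lra|apply ex_RInt_gamma_integrand; lra|].
    intros; left; apply gamma_integrand_pos. }
  change (RInt (gamma_integrand x) a b <= RInt (gamma_integrand x) a' a +
     (RInt (gamma_integrand x) a b + RInt (gamma_integrand x) b b')); lra.
Qed.

(** The integrand is positive, so its integrals over compact intervals increase
    with the interval; being bounded, they converge to their supremum. *)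
Lemma Gamma_converges x :
  0 < x ->
  exists l, 0 < l /\
    is_RInt_gen (gamma_integrand x) (at_right 0) (Rbar_locally p_infty) l.
Proof.
  intros Hx.
  destruct (RInt_gamma_integrand_near_infty x) as [B HB].
  set (E := fun r => exists a b, 0 < a <= 1 /\ 1 <= b /\ r = RInt (gamma_integrand x) a b).
  assert (HE : forall a b, 0 < a <= 1 -> 1 <= b -> RInt (gamma_integrand x) a b <= / x + B).
  { intros a b Ha Hb.
    rewrite <- (RInt_Chasles (gamma_integrand x) a 1 b)
      by (apply ex_RInt_gamma_integrand; lra).
    apply Rplus_le_compat; [apply RInt_gamma_integrand_near_0|apply HB]; lra. }
  destruct (completeness E) as [l [Hub Hlub]].
  { exists (/ x + B); intros r (a & b & Ha & Hb & ->); apply HE; lra. }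
  { exists (RInt (gamma_integrand x) 1 1), 1, 1; split; [lra|split; [lra|reflexivity]]. }
  exists l; split.
  - apply Rlt_le_trans with (RInt (gamma_integrand x) 1 2).
    + apply RInt_gt_0; [lra| |].
      * intros; apply gamma_integrand_pos.
      * intros; apply gamma_integrand_continuous; lra.
    + apply Hub; exists 1, 2; split; [lra|split; [lra|reflexivity]].
  - intros P [eps HP].
    assert (Hex : exists a0 b0, 0 < a0 <= 1 /\ 1 <= b0 /\
                   l - eps < RInt (gamma_integrand x) a0 b0).
    { apply NNPP; intros Hn.
      assert (H1 : l <= l - eps); [|generalize (cond_pos eps); lra].
      apply Hlub; intros r (a & b & Ha & Hb & ->).
      apply Rnot_lt_le; intros Hlt; apply Hn; exists a, b; auto. }
    destruct Hex as (a0 & b0 & Ha0 & Hb0 & Hlt).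
    apply (Filter_prod _ _ _ (fun a => 0 < a < a0) (fun b => b0 < b)).
    + exists (mkposreal a0 (proj1 Ha0)); intros y Hy Hy0.
      change (Rabs (y - 0) < a0) in Hy.
      rewrite Rminus_0_r, Rabs_pos_eq in Hy by lra; lra.
    + exists b0; auto.
    + intros a b Ha Hb; simpl.
      exists (RInt (gamma_integrand x) a b); split.
      * apply (RInt_correct (V := R_CompleteNormedModule)).
        apply ex_RInt_gamma_integrand; lra.
      * apply HP.
        change (Rabs (RInt (gamma_integrand x) a b - l) < eps).
        assert (H1 : RInt (gamma_integrand x) a b <= l).
        { apply Hub; exists a, b; split; [lra|split; [lra|reflexivity]]. }
        assert (H2 : RInt (gamma_integrand x) a0 b0 <= RInt (gamma_integrand x) a b)
          by (apply RInt_gamma_integrand_incr; lra).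
        rewrite Rabs_left1; lra.
Qed.

Lemma is_RInt_gen_Gamma x :
  0 < x ->
  is_RInt_gen (gamma_integrand x) (at_right 0) (Rbar_locally p_infty) (Gamma x).
Proof.
  intros Hx; destruct (Gamma_converges x Hx) as (l & _ & Hl).
  unfold Gamma; fold (gamma_integrand x).
  apply (RInt_gen_correct (V := R_CompleteNormedModule)); exists l; exact Hl.
Qed.

Lemma Gamma_pos x : 0 < x -> 0 < Gamma x.
Proof.
  intros Hx; destruct (Gamma_converges x Hx) as (l & Hl0 & Hl).
  unfold Gamma; fold (gamma_integrand x).
  rewrite (is_RInt_gen_unique (V := R_CompleteNormedModule) _ _ Hl); exact Hl0.
Qed.

Lemma gamma_boundary_infty x :
  0 < x -> is_lim (gamma_integrand (x + 1)) p_infty 0.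
Proof.
  intros Hx.
  apply (is_lim_ext_loc (fun t => exp (t * (x * (ln t / t) - 1)))).
  { exists 0; intros t Ht; unfold gamma_integrand, Rpower.
    rewrite <- exp_plus; f_equal; field; lra. }
  apply (is_lim_comp exp _ p_infty 0 m_infty); [apply is_lim_exp_m| |].
  - replace m_infty with (Rbar_mult p_infty (Finite (-1)))
      by (apply is_Rbar_mult_unique, is_Rbar_mult_p_infty_neg; simpl; lra).
    apply (is_lim_mult _ _ p_infty p_infty (Finite (-1))).
    + apply is_lim_id.
    + replace (-1) with (x * 0 - 1) by ring.
      apply (is_lim_minus' _ _ p_infty (x * 0) 1); [|apply is_lim_const].
      apply (is_lim_scal_l (fun t => ln t / t) x p_infty 0), is_lim_div_ln_p.
    + simpl; lra.
  - exists 0; intros; discriminate.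
Qed.

Lemma gamma_boundary_0 x :
  0 < x -> filterlim (gamma_integrand (x + 1)) (at_right 0) (locally 0).
Proof.
  intros Hx P [eps HP].
  exists (mkposreal _ (exp_pos (ln eps / x))); intros y Hy Hy0.
  change (Rabs (y - 0) < exp (ln eps / x)) in Hy.
  rewrite Rminus_0_r, Rabs_pos_eq in Hy by lra.
  apply HP; change (Rabs (gamma_integrand (x + 1) y - 0) < eps).
  rewrite Rminus_0_r, Rabs_pos_eq by (left; apply gamma_integrand_pos).
  unfold gamma_integrand, Rpower; rewrite <- exp_plus.
  rewrite <- (exp_ln eps) at 1 by apply cond_pos.
  apply exp_increasing.
  assert (Hln : ln y < ln eps / x) by (rewrite <- (ln_exp (ln eps / x)); apply ln_increasing; lra).
  apply (Rmult_lt_compat_l x) in Hln; [|lra].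
  replace (x * (ln eps / x)) with (ln eps) in Hln by (field; lra). lra.
Qed.

Lemma gamma_integrand_succ x t :
  0 < t -> gamma_integrand (x + 1) t = t * gamma_integrand x t.
Proof.
  intros Ht; unfold gamma_integrand.
  replace (x + 1 - 1) with (x - 1 + 1) by ring.
  rewrite Rpower_plus, Rpower_1 by exact Ht; ring.
Qed.

Lemma is_derive_gamma_integrand x t :
  0 < t ->
  is_derive (gamma_integrand (x + 1)) t (x * gamma_integrand x t - gamma_integrand (x + 1) t).
Proof.
  intros Ht; unfold gamma_integrand, Rpower; auto_derive; [lra|].
  replace ((x - 1) * ln t) with ((x + 1 - 1) * ln t + - ln t) by ring.
  rewrite exp_plus, (exp_Ropp (ln t)), exp_ln by lra; field; lra.
Qed.

(** Integration by parts in the form: the derivative of t^x e^(-t) is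
    x t^(x-1) e^(-t) - t^x e^(-t), and t^x e^(-t) vanishes at both ends. *)
Lemma Gamma_succ x : 0 < x -> Gamma (x + 1) = x * Gamma x.
Proof.
  intros Hx.
  set (d := fun t => x * gamma_integrand x t - gamma_integrand (x + 1) t).
  assert (Hd : forall t, 0 < t -> is_derive (gamma_integrand (x + 1)) t (d t))
    by (intros t; apply is_derive_gamma_integrand).
  assert (Hpos : filter_prod (at_right 0) (Rbar_locally p_infty)
            (fun ab : R * R => forall t, Rmin (fst ab) (snd ab) <= t <= Rmax (fst ab) (snd ab) -> 0 < t)).
  { apply (Filter_prod _ _ _ (fun a => 0 < a) (fun b => 0 < b)).
    - exists (mkposreal 1 Rlt_0_1); auto.
    - exists 0; auto.
    - intros a b Ha Hb t [Ht _]; simpl in Ht; unfold Rmin in Ht.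
      destruct (Rle_dec a b); lra. }
  assert (Hdc : forall t, 0 < t -> continuous (Derive (gamma_integrand (x + 1))) t).
  { intros t Ht.
    apply (continuous_ext_loc _ d).
    - exists (mkposreal t Ht); intros y Hy; change (Rabs (y - t) < t) in Hy.
      symmetry; apply is_derive_unique, Hd; apply Rabs_def2 in Hy; lra.
    - unfold d; apply (continuous_minus (V := R_NormedModule)).
      + apply (continuous_scal_r x (gamma_integrand x)), gamma_integrand_continuous, Ht.
      + apply gamma_integrand_continuous, Ht. }
  assert (H1 : is_RInt_gen (Derive (gamma_integrand (x + 1))) (at_right 0) (Rbar_locally p_infty) (0 - 0)).
  { apply is_RInt_gen_Derive.
    - apply (filter_imp _ _ (fun ab H t Ht => ex_intro _ _ (Hd t (H t Ht))) Hpos).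
    - apply (filter_imp _ _ (fun ab H t Ht => Hdc t (H t Ht)) Hpos).
    - apply gamma_boundary_0, Hx.
    - apply gamma_boundary_infty, Hx. }
  assert (H2 : is_RInt_gen (Derive (gamma_integrand (x + 1))) (at_right 0) (Rbar_locally p_infty)
                 (minus (scal x (Gamma x)) (Gamma (x + 1)))).
  { apply (is_RInt_gen_ext (fun t => minus (scal x (gamma_integrand x t)) (gamma_integrand (x + 1) t))).
    - refine (filter_imp _ _ _ Hpos); intros ab H t Ht.
      symmetry; apply is_derive_unique, Hd, H; lra.
    - apply (is_RInt_gen_minus (V := R_NormedModule)).
      + apply (is_RInt_gen_scal (V := R_NormedModule)), is_RInt_gen_Gamma, Hx.
      + apply is_RInt_gen_Gamma; lra. }
  apply (is_RInt_gen_unique (V := R_CompleteNormedModule)) in H1.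
  apply (is_RInt_gen_unique (V := R_CompleteNormedModule)) in H2.
  rewrite H1 in H2; change (0 - 0 = x * Gamma x - Gamma (x + 1)) in H2; lra.
Qed.

(** * Power series with infinite radius of convergence *)

Definition entire (a : nat -> R) : Prop := CV_radius a = p_infty.

Lemma entire_radius a x : entire a -> Rbar_lt (Rabs x) (CV_radius a).
Proof. intros ->; exact I. Qed.

Lemma entire_ex_series a x : entire a -> ex_series (fun k => a k * x ^ k).
Proof. intros Ha; apply ex_pseries_R, CV_radius_inside, entire_radius, Ha. Qed.

Lemma entire_ex_pseries a x : entire a -> ex_pseries a x.
Proof. intros Ha; apply CV_radius_inside, entire_radius, Ha. Qed.

Lemma entire_of_bounded a :
  (forall r, exists M, forall n, Rabs (a n * r ^ n) <= M) -> entire a.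
Proof.
  intros H; destruct (CV_radius_bounded a) as [Hub _]; unfold entire.
  destruct (CV_radius a) as [r| |]; [|reflexivity|].
  - specialize (Hub _ (H (r + 1))); simpl in Hub; lra.
  - destruct (Hub _ (H 0)).
Qed.

Lemma entire_finite_support a n : (forall k, (n < k)%nat -> a k = 0) -> entire a.
Proof.
  revert a; induction n as [|n IH]; intros a Ha; unfold entire.
  - apply entire_of_bounded; intros r; exists (Rabs (a 0%nat)); intros [|k].
    + simpl; rewrite Rmult_1_r; lra.
    + rewrite Ha, Rmult_0_l, Rabs_R0 by lia; apply Rabs_pos.
  - rewrite <- CV_radius_decr_1; apply IH; intros k Hk; apply Ha; lia.
Qed.

Lemma entire_derive a : entire a -> entire (PS_derive a).
Proof. unfold entire; rewrite CV_radius_derive; auto. Qed.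

Lemma entire_incr a : entire a -> entire (PS_incr_1 a).
Proof. unfold entire; rewrite CV_radius_incr_1; auto. Qed.

(** Closure under the Euler operator x d/dx. *)
Lemma entire_euler a : entire a -> entire (fun k => INR k * a k).
Proof.
  intros Ha; unfold entire; rewrite (CV_radius_ext _ (PS_incr_1 (PS_derive a))).
  - apply entire_incr, entire_derive, Ha.
  - intros [|k]; [simpl; apply Rmult_0_l|reflexivity].
Qed.

Lemma is_derive_entire a x :
  entire a -> is_derive (PSeries a) x (PSeries (PS_derive a) x).
Proof. intros Ha; apply is_derive_PSeries, entire_radius, Ha. Qed.

Definition cvg_locally_uniform (g_ : nat -> R -> R) (g : R -> R) : Prop :=
  forall X eps, 0 < eps ->
  exists N, forall n, (N <= n)%nat ->
  forall x, Rabs x <= X -> Rabs (g_ n x - g x) < eps.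

(** The error on |x| <= X is at most (1/n) times the majorant series at |X|. *)
Lemma cvg_locally_uniform_PSeries (b : nat -> nat -> R) (a e : nat -> R) :
  entire a -> (forall n, entire (b n)) -> entire e ->
  (forall n k, (0 < n)%nat -> Rabs (b n k - a k) <= e k / INR n) ->
  cvg_locally_uniform (fun n => PSeries (b n)) (PSeries a).
Proof.
  intros Ha Hb He Hbe X eps Heps.
  destruct (INR_unbounded (Rabs (PSeries e (Rabs X)) / eps)) as [N HN].
  exists (S N); intros n Hn x Hx.
  assert (Hn0 : 0 < INR n) by (apply lt_0_INR; lia).
  assert (Hsum : ex_series (fun k => e k * Rabs X ^ k / INR n)).
  { apply (ex_series_scal_r (/ INR n)), entire_ex_series, He. }
  assert (Hle : forall k, 0 <= Rabs (b n k * x ^ k - a k * x ^ k) <= e k * Rabs X ^ k / INR n).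
  { intros k; split; [apply Rabs_pos|].
    rewrite <- Rmult_minus_distr_r, Rabs_mult, <- RPow_abs.
    replace (e k * Rabs X ^ k / INR n) with (e k / INR n * Rabs X ^ k) by (field; lra).
    apply Rmult_le_compat; try apply Rabs_pos.
    - apply pow_le, Rabs_pos.
    - apply Hbe; lia.
    - apply pow_incr; split; [apply Rabs_pos|].
      apply Rle_trans with (1 := Hx), Rle_abs. }
  unfold PSeries; rewrite <- Series_minus by (apply entire_ex_series; auto).
  assert (Habs : ex_series (fun k => Rabs (b n k * x ^ k - a k * x ^ k))).
  { apply (ex_series_le (V := R_CompleteNormedModule) _ _ (fun k => Rle_trans _ _ _
      (Req_le _ _ (Rabs_Rabsolu _)) (proj2 (Hle k))) Hsum). }
  apply Rle_lt_trans with (1 := Series_Rabs _ Habs).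
  apply Rle_lt_trans with (1 := Series_le _ _ Hle Hsum).
  unfold Rdiv; rewrite Series_scal_r; fold (PSeries e (Rabs X)).
  apply Rle_lt_trans with (Rabs (PSeries e (Rabs X)) * / INR n).
  - apply Rmult_le_compat_r; [left; apply Rinv_0_lt_compat, Hn0|apply Rle_abs].
  - apply (Rmult_lt_reg_r (INR n)); [exact Hn0|].
    rewrite Rmult_assoc, Rinv_l, Rmult_1_r by lra.
    apply (Rmult_lt_compat_r eps) in HN; [|exact Heps].
    unfold Rdiv in HN; rewrite Rmult_assoc, Rinv_l, Rmult_1_r in HN by lra.
    apply Rlt_le_trans with (1 := HN); rewrite Rmult_comm.
    apply Rmult_le_compat_l; [lra|]; apply le_INR; lia.
Qed.

(** * The entire function behind the Bessel functions *)

Lemma is_lim_seq_inv_INR : is_lim_seq (fun n => / INR n) 0.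
Proof.
  apply (is_lim_seq_inv INR p_infty); [apply is_lim_seq_INR|discriminate].
Qed.

Fixpoint bcoef (mu : R) (k : nat) : R :=
  match k with
  | O => 1
  | S k' => bcoef mu k' / (INR k * (INR k + mu))
  end.

Lemma bcoef_S mu k :
  bcoef mu (S k) = bcoef mu k / ((INR k + 1) * (INR k + 1 + mu)).
Proof. rewrite <- S_INR; reflexivity. Qed.

Lemma bcoef_pos mu k : -1 < mu -> 0 < bcoef mu k.
Proof.
  intros Hmu; induction k as [|k IH]; [simpl; lra|].
  rewrite bcoef_S; generalize (pos_INR k); intros Hk.
  apply Rdiv_lt_0_compat, Rmult_lt_0_compat; lra.
Qed.

Lemma bcoef_rec mu k :
  -1 < mu -> bcoef mu k = (INR k + 1) * (INR k + 1 + mu) * bcoef mu (S k).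
Proof.
  intros Hmu; rewrite bcoef_S; generalize (pos_INR k); intros Hk; field; lra.
Qed.

Lemma entire_bcoef mu : -1 < mu -> entire (bcoef mu).
Proof.
  intros Hmu; apply CV_radius_infinite_DAlembert.
  - intros k; generalize (bcoef_pos mu k Hmu); lra.
  - apply (is_lim_seq_le_le (fun _ => 0) _ (fun k => / (1 + mu) * / INR (S k))).
    + intros k; rewrite bcoef_S; generalize (bcoef_pos mu k Hmu); intros Hb.
      generalize (pos_INR k); intros Hk.
      replace (bcoef mu k / ((INR k + 1) * (INR k + 1 + mu)) / bcoef mu k)
        with (/ (INR k + 1 + mu) * / INR (S k)) by (rewrite S_INR; field; lra).
      assert (H1 : 0 < / (INR k + 1 + mu)) by (apply Rinv_0_lt_compat; lra).
      assert (H2 : 0 < / INR (S k)) by (apply Rinv_0_lt_compat, lt_0_INR; lia).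
      rewrite Rabs_pos_eq by (left; apply Rmult_lt_0_compat; lra).
      split; [left; apply Rmult_lt_0_compat; lra|].
      apply Rmult_le_compat_r; [lra|]; apply Rinv_le_contravar; lra.
    + apply is_lim_seq_const.
    + replace (Finite 0) with (Rbar_mult (/ (1 + mu)) 0) by (simpl; f_equal; ring).
      apply is_lim_seq_scal_l.
      apply (is_lim_seq_incr_1 (fun k => / INR k)), is_lim_seq_inv_INR.
Qed.

(** The hypergeometric function 0F1(; mu + 1; x), that is
    Gamma(mu + 1) x^(-mu/2) I_mu(2 sqrt x) for x > 0. *)
Definition bfun (mu : R) : R -> R := PSeries (bcoef mu).
Definition bfun' (mu : R) : R -> R := PSeries (PS_derive (bcoef mu)).
Definition bfun'' (mu : R) : R -> R := PSeries (PS_derive (PS_derive (bcoef mu))).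

Lemma is_derive_bfun mu x : -1 < mu -> is_derive (bfun mu) x (bfun' mu x).
Proof. intros Hmu; apply is_derive_entire, entire_bcoef, Hmu. Qed.

Lemma is_derive_bfun' mu x : -1 < mu -> is_derive (bfun' mu) x (bfun'' mu x).
Proof. intros Hmu; apply is_derive_entire, entire_derive, entire_bcoef, Hmu. Qed.

Lemma bfun_0 mu : bfun mu 0 = 1.
Proof. apply PSeries_0. Qed.

Lemma bfun'_0 mu : bfun' mu 0 = / (1 + mu).
Proof.
  unfold bfun'; rewrite PSeries_0; unfold PS_derive; simpl.
  rewrite !Rmult_1_l; apply Rmult_1_l.
Qed.

Lemma Series_nonneg a : (forall n, 0 <= a n) -> ex_series a -> 0 <= Series a.
Proof.
  intros Ha Hex; rewrite <- (Rmult_0_l (Series a)), <- Series_scal_l.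
  apply Series_le; [|exact Hex].
  intros n; rewrite Rmult_0_l; split; [lra|apply Ha].
Qed.

Lemma PSeries_coef_pos a x : entire a -> (forall k, 0 < a k) -> 0 <= x -> 0 < PSeries a x.
Proof.
  intros He Ha Hx; rewrite PSeries_decr_1 by apply entire_ex_pseries, He.
  assert (H : 0 <= PSeries (PS_decr_1 a) x).
  { apply Series_nonneg.
    - intros k; apply Rmult_le_pos; [left; apply Ha|apply pow_le, Hx].
    - apply entire_ex_series; unfold entire; rewrite CV_radius_decr_1; exact He. }
  generalize (Ha 0%nat); nra.
Qed.

Lemma bfun_pos mu x : -1 < mu -> 0 <= x -> 0 < bfun mu x.
Proof.
  intros Hmu; apply PSeries_coef_pos; [apply entire_bcoef, Hmu|].
  intros k; apply bcoef_pos, Hmu.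
Qed.

(** Bessel's equation in the variable x = z^2/4; on coefficients it is the
    recursion defining [bcoef]. *)
Lemma bfun_ode mu x :
  -1 < mu -> x * bfun'' mu x + (mu + 1) * bfun' mu x = bfun mu x.
Proof.
  intros Hmu; unfold bfun'', bfun', bfun.
  rewrite <- PSeries_incr_1, <- PSeries_scal, <- PSeries_plus.
  - apply PSeries_ext; intros k.
    destruct k as [|k].
    + change (0 + (mu + 1) * (INR 1 * bcoef mu 1) = 1).
      rewrite bcoef_S; simpl; field; lra.
    + change (INR (S k) * (INR (S (S k)) * bcoef mu (S (S k)))
              + (mu + 1) * (INR (S (S k)) * bcoef mu (S (S k))) = bcoef mu (S k)).
      generalize (pos_INR k); intros Hk.
      rewrite (bcoef_S mu (S k)), !S_INR; field; lra.
  - apply entire_ex_pseries, entire_incr, entire_derive, entire_derive, entire_bcoef, Hmu.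
  - apply ex_pseries_scal; [apply Rmult_comm|].
    apply entire_ex_pseries, entire_derive, entire_bcoef, Hmu.
Qed.

Lemma bcoef_shift nu k :
  -1 < nu -> bcoef nu k = (1 + INR k / (nu + 1)) * bcoef (nu + 1) k.
Proof.
  intros Hnu; induction k as [|k IH]; [simpl; field; lra|].
  rewrite !bcoef_S, IH, S_INR; generalize (pos_INR k); intros Hk; field; lra.
Qed.

(** The recurrence z I_nu = 2 (nu + 1) I_(nu+1) + z I_(nu+2), with I_(nu+2)
    expressed by the derivative of the function of order nu + 1. *)
Lemma bfun_contiguous nu x :
  -1 < nu -> bfun nu x = bfun (nu + 1) x + / (nu + 1) * (x * bfun' (nu + 1) x).
Proof.
  intros Hnu; assert (Hmu : -1 < nu + 1) by lra; unfold bfun', bfun.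
  rewrite <- PSeries_incr_1, <- PSeries_scal, <- PSeries_plus.
  - apply PSeries_ext; intros k; rewrite (bcoef_shift nu k Hnu).
    destruct k as [|k].
    + change ((1 + 0 / (nu + 1)) * 1 = 1 + / (nu + 1) * 0); field; lra.
    + change ((1 + INR (S k) / (nu + 1)) * bcoef (nu + 1) (S k)
              = bcoef (nu + 1) (S k) + / (nu + 1) * (INR (S k) * bcoef (nu + 1) (S k))).
      field; lra.
  - apply entire_ex_pseries, entire_bcoef, Hmu.
  - apply ex_pseries_scal; [apply Rmult_comm|].
    apply entire_ex_pseries, entire_incr, entire_derive, entire_bcoef, Hmu.
Qed.

Lemma inv_fact_Gamma mu k :
  -1 < mu ->
  / (INR (fact k) * Gamma (INR k + mu + 1)) = / Gamma (mu + 1) * bcoef mu k.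
Proof.
  intros Hmu; assert (HG : 0 < Gamma (mu + 1)) by (apply Gamma_pos; lra).
  induction k as [|k IH].
  - simpl; rewrite Rmult_1_l, Rplus_0_l; ring.
  - rewrite bcoef_S.
    replace (/ Gamma (mu + 1) * (bcoef mu k / ((INR k + 1) * (INR k + 1 + mu))))
      with (/ Gamma (mu + 1) * bcoef mu k * / ((INR k + 1) * (INR k + 1 + mu)))
      by (unfold Rdiv; ring).
    rewrite <- IH, <- Rinv_mult; f_equal.
    generalize (pos_INR k); intros Hk.
    rewrite fact_simpl, mult_INR, S_INR.
    replace (INR k + 1 + mu + 1) with (INR k + mu + 1 + 1) by ring.
    rewrite Gamma_succ by lra; ring.
Qed.

Lemma Rpower_bessel mu z k :
  0 < z -> Rpower (z / 2) (2 * INR k + mu) = Rpower (z / 2) mu * (z ^ 2 / 4) ^ k.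
Proof.
  intros Hz; rewrite Rplus_comm, Rpower_plus; f_equal.
  rewrite <- Rpower_mult, Rpower_pow by apply exp_pos; f_equal.
  replace 2 with (INR 2) at 2 by reflexivity.
  rewrite Rpower_pow by lra; field.
Qed.

Lemma bessel_I_bfun mu z :
  -1 < mu -> 0 < z ->
  bessel_I mu z = Rpower (z / 2) mu / Gamma (mu + 1) * bfun mu (z ^ 2 / 4).
Proof.
  intros Hmu Hz; unfold bessel_I, bfun, PSeries.
  rewrite <- Series_scal_l; apply Series_ext; intros k; unfold Rdiv at 1.
  rewrite inv_fact_Gamma, Rpower_bessel by assumption; unfold Rdiv; ring.
Qed.

Lemma bessel_J_bfun mu z :
  -1 < mu -> 0 < z ->
  bessel_J mu z = Rpower (z / 2) mu / Gamma (mu + 1) * bfun mu (- (z ^ 2 / 4)).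
Proof.
  intros Hmu Hz; unfold bessel_J, bfun, PSeries.
  rewrite <- Series_scal_l; apply Series_ext; intros k; unfold Rdiv at 1.
  rewrite inv_fact_Gamma, Rpower_bessel by assumption.
  replace (- (z ^ 2 / 4)) with (-1 * (z ^ 2 / 4)) by ring.
  rewrite Rpow_mult_distr; unfold Rdiv; ring.
Qed.

Lemma bessel_J_eq_0 mu z :
  -1 < mu -> 0 < z -> (bessel_J mu z = 0 <-> bfun mu (- (z ^ 2 / 4)) = 0).
Proof.
  intros Hmu Hz; rewrite bessel_J_bfun by assumption.
  assert (H : 0 < Rpower (z / 2) mu / Gamma (mu + 1)).
  { apply Rdiv_lt_0_compat; [apply exp_pos|apply Gamma_pos; lra]. }
  split; intros H0; [|rewrite H0; ring].
  apply Rmult_integral in H0; destruct H0; [lra|assumption].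
Qed.

Lemma G_bfun nu s :
  -1 < nu -> 0 < s ->
  G nu s = 2 * (nu + 1) + 2 * (s / 4 * (bfun' (nu + 1) (s / 4) / bfun (nu + 1) (s / 4))).
Proof.
  intros Hnu Hs; assert (Hz : 0 < sqrt s) by (apply sqrt_lt_R0, Hs).
  unfold G, W; rewrite !bessel_I_bfun by lra.
  replace (sqrt s ^ 2) with s by (simpl; rewrite Rmult_1_r, sqrt_sqrt; lra).
  rewrite Rpower_plus, Rpower_1 by lra.
  rewrite (Gamma_succ (nu + 1)), (bfun_contiguous nu) by lra.
  assert (H1 : 0 < Gamma (nu + 1)) by (apply Gamma_pos; lra).
  assert (H2 : 0 < Rpower (sqrt s / 2) nu) by apply exp_pos.
  assert (H3 : 0 < bfun (nu + 1) (s / 4)) by (apply bfun_pos; lra).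
  field; repeat split; lra.
Qed.

(** * Energy: simple zeros and decay of the logarithmic derivative *)

Lemma mean_value (f f' : R -> R) (a b : R) :
  a < b -> (forall x, a <= x <= b -> is_derive f x (f' x)) ->
  exists c, a < c < b /\ f b - f a = f' c * (b - a).
Proof.
  intros Hab Hf; destruct (MVT_cor2 f f' a b Hab) as (c & H1 & H2).
  - intros c Hc; apply is_derive_Reals, Hf, Hc.
  - exists c; auto.
Qed.

Lemma is_derive_continuity_pt f x l : is_derive f x l -> continuity_pt f x.
Proof.
  intros H; apply continuity_pt_filterlim.
  apply (ex_derive_continuous (V := R_NormedModule)); exists l; exact H.
Qed.

Definition bfun_energy (mu x : R) : R := bfun mu x ^ 2 - x * bfun' mu x ^ 2.

Lemma is_derive_bfun_energy mu x :
  -1 < mu -> is_derive (bfun_energy mu) x ((2 * mu + 1) * bfun' mu x ^ 2).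
Proof.
  intros Hmu.
  assert (H0 := is_derive_bfun mu x Hmu); assert (H1 := is_derive_bfun' mu x Hmu).
  unfold bfun_energy; auto_derive.
  - repeat split; eexists; eassumption.
  - rewrite (is_derive_unique (fun y : R => bfun mu y) x _ H0), (is_derive_unique (fun y : R => bfun' mu y) x _ H1).
    rewrite <- (bfun_ode mu x Hmu); ring.
Qed.

(** The energy F^2 - x F'^2 has derivative (2 mu + 1) F'^2 >= 0 and value 1
    at 0. *)
Lemma bfun'_le_bfun mu x :
  -1 / 2 <= mu -> 0 < x -> x * bfun' mu x ^ 2 <= bfun mu x ^ 2.
Proof.
  intros Hmu Hx.
  destruct (mean_value (bfun_energy mu) (fun x => (2 * mu + 1) * bfun' mu x ^ 2) 0 x Hx)
    as (c & _ & Hc).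
  { intros y _; apply is_derive_bfun_energy; lra. }
  assert (0 <= (2 * mu + 1) * bfun' mu c ^ 2 * (x - 0)).
  { assert (Hsq := pow2_ge_0 (bfun' mu c)).
    apply Rmult_le_pos; [apply Rmult_le_pos|]; lra. }
  unfold bfun_energy in Hc; rewrite bfun_0 in Hc; lra.
Qed.

(** Uniqueness for the differential equation, which is singular at 0 where F is
    normalised. To the left of 0 the energy E = F^2 + |x| F'^2 is nonnegative and
    E |x|^m decreases as soon as m >= 2 mu + 1. A double zero makes it vanish
    there, hence on the whole way up to 0, where F = 1. *)
Lemma bfun_simple_zeros mu x :
  -1 < mu -> x < 0 -> bfun mu x = 0 -> bfun' mu x <> 0.
Proof.
  intros Hmu Hx H0 H1.
  destruct (INR_unbounded (2 * mu + 1)) as [m Hm].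
  set (Phi := fun y => bfun_energy mu y * (- y) ^ S m).
  assert (Hzero : forall y, x < y < 0 -> bfun mu y = 0).
  { intros y Hy.
    destruct (mean_value Phi
      (fun y => (2 * mu + 1) * bfun' mu y ^ 2 * (- y) ^ S m
                - bfun_energy mu y * (INR (S m) * (- y) ^ m)) x y) as (c & Hc & Heq); [lra| |].
    { intros u _; unfold Phi; assert (HE := is_derive_bfun_energy mu u Hmu).
      auto_derive; [repeat split; eexists; exact HE|].
      rewrite (is_derive_unique (fun y : R => bfun_energy mu y) u _ HE).
      rewrite S_INR; simpl; destruct m; simpl; ring. }
    assert (HPx : Phi x = 0) by (unfold Phi, bfun_energy; rewrite H0, H1; ring).
    assert (Hneg : (2 * mu + 1) * bfun' mu c ^ 2 * (- c) ^ S m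
                - bfun_energy mu c * (INR (S m) * (- c) ^ m) <= 0).
    { rewrite S_INR; unfold bfun_energy.
      replace (_ - _) with
        (- ((- c) ^ m * ((INR m - 2 * mu) * (- c * bfun' mu c ^ 2) + (INR m + 1) * bfun mu c ^ 2)))
        by (simpl; ring).
      assert (Hp : 0 <= (- c) ^ m) by (apply pow_le; lra).
      assert (Hs1 := pow2_ge_0 (bfun' mu c)); assert (Hs2 := pow2_ge_0 (bfun mu c)).
      assert (Hm0 := pos_INR m).
      assert (0 <= (- c) ^ m * ((INR m - 2 * mu) * (- c * bfun' mu c ^ 2)
                 + (INR m + 1) * bfun mu c ^ 2)); [|lra].
      apply Rmult_le_pos; [exact Hp|].
      apply Rplus_le_le_0_compat; apply Rmult_le_pos; try lra.
      apply Rmult_le_pos; lra. }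
    assert (HPy : Phi y <= 0) by nra.
    assert (Hpy : 0 < (- y) ^ S m) by (apply pow_lt; lra).
    assert (HEy : bfun_energy mu y <= 0) by (unfold Phi in HPy; nra).
    assert (Hs1 := pow2_ge_0 (bfun' mu y)); unfold bfun_energy in HEy; nra. }
  assert (Hcont := is_derive_continuity_pt _ _ _ (is_derive_bfun mu 0 Hmu)).
  destruct (Hcont (1 / 2)) as (d & Hd & Hlim); [lra|].
  (* a point of ]x, 0[ close enough to 0 for F to be near F(0) = 1 *)
  set (y := Rmax (x / 2) (- (d / 2))).
  assert (Hy : x < y < 0 /\ - d < y).
  { unfold y, Rmax; destruct (Rle_dec (x / 2) (- (d / 2))); lra. }
  specialize (Hlim y); simpl in Hlim; unfold R_dist in Hlim.
  rewrite bfun_0, (Hzero y) in Hlim by tauto.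
  assert (Hlim' : Rabs (0 - 1) < 1 / 2).
  { apply Hlim; split; [split; [exact I|lra]|].
    rewrite Rminus_0_r; apply Rabs_def1; lra. }
  rewrite Rabs_left in Hlim'; lra.
Qed.

(** * Polynomials of degree n with n known roots *)

(** Polynomial functions of degree at most n, in Horner form: this is the shape
    on which synthetic division recurses. *)
Fixpoint is_poly (n : nat) (g : R -> R) : Prop :=
  match n with
  | O => exists c, forall x, g x = c
  | S m => exists c h, is_poly m h /\ forall x, g x = c + x * h x
  end.

Lemma is_poly_comb n g h a :
  is_poly n g -> is_poly n h -> is_poly n (fun x => g x + a * h x).
Proof.
  revert g h; induction n as [|n IH]; intros g h.
  - intros [c Hc] [d Hd]; exists (c + a * d); intros x; rewrite Hc, Hd; ring.
  - intros (c & g1 & Hg1 & Hg) (d & h1 & Hh1 & Hh).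
    exists (c + a * d), (fun x => g1 x + a * h1 x); split; [apply IH; assumption|].
    intros x; rewrite Hg, Hh; ring.
Qed.

Lemma is_poly_weaken n g : is_poly n g -> is_poly (S n) g.
Proof.
  revert g; induction n as [|n IH]; intros g.
  - intros [c Hc]; exists c, (fun _ => 0); split; [exists 0; reflexivity|].
    intros x; rewrite Hc; ring.
  - intros (c & h & Hh & Hg); exists c, h; split; [apply IH, Hh|exact Hg].
Qed.

(** Synthetic division: g = c + x h and h = h(a) + (x - a) q give
    g = g(a) + (x - a) (h + a q). *)
Lemma is_poly_quotient n g a :
  is_poly (S n) g -> exists q, is_poly n q /\ forall x, g x = g a + (x - a) * q x.
Proof.
  revert g; induction n as [|n IH]; intros g (c & h & Hh & Hg).
  - destruct Hh as [d Hd]; exists (fun _ => d); split; [exists d; reflexivity|].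
    intros x; rewrite !Hg, !Hd; ring.
  - destruct (IH h Hh) as (q & Hq & Hhq).
    exists (fun x => h x + a * q x); split.
    + apply is_poly_comb; [exact Hh|apply is_poly_weaken, Hq].
    + intros x; rewrite !Hg, (Hhq x); ring.
Qed.

(** Normalised to the value 1 at 0, so that no leading coefficient appears. *)
Definition prod_roots (l : list R) (x : R) : R :=
  fold_right (fun r p => (1 - x / r) * p) 1 l.

Lemma is_poly_factor l g :
  is_poly (length l) g -> NoDup l ->
  (forall r, In r l -> r <> 0 /\ g r = 0) ->
  forall x, g x = g 0 * prod_roots l x.
Proof.
  revert g; induction l as [|r l IH]; intros g Hg Hnd Hr x.
  - destruct Hg as [c Hc]; rewrite !Hc; simpl; ring.
  - destruct (Hr r (or_introl eq_refl)) as [Hr0 Hgr].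
    destruct (is_poly_quotient _ _ r Hg) as (q & Hq & Hgq).
    inversion_clear Hnd as [|? ? Hnin Hnd'].
    rewrite (Hgq x), (Hgq 0), Hgr.
    rewrite (IH q Hq Hnd'); [simpl; field; exact Hr0|].
    intros s Hs; destruct (Hr s (or_intror Hs)) as [Hs0 Hgs]; split; [exact Hs0|].
    rewrite Hgq, Hgr, Rplus_0_l in Hgs.
    apply Rmult_integral in Hgs; destruct Hgs as [Hsr|]; [|assumption].
    replace s with r in Hs by lra; contradiction.
Qed.

(** * Sign alternation *)

(** Recursion on the last of k + 1 points: inductions then extend or move the
    chain at its right end, and roots found in the last gap are new. *)
Fixpoint alternates (g : R -> R) (k : nat) (T : R) : Prop :=
  match k with
  | O => 0 < T /\ 0 < g T
  | S k' => (exists T', T' < T /\ alternates g k' T') /\ 0 < (-1) ^ k * g T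
  end.

Lemma alternates_pos g k T : alternates g k T -> 0 < T.
Proof.
  revert T; induction k as [|k IH]; intros T; simpl; [tauto|].
  intros [(T' & HT & H) _]; specialize (IH T' H); lra.
Qed.

Lemma alternates_sign g k T : alternates g k T -> 0 < (-1) ^ k * g T.
Proof. destruct k; simpl; [lra|tauto]. Qed.

Lemma alternates_roots g k T :
  continuity g -> alternates g k T ->
  exists l, NoDup l /\ length l = k /\ forall r, In r l -> 0 < r < T /\ g r = 0.
Proof.
  intros Hg; revert T; induction k as [|k IH]; intros T HT.
  - exists nil; repeat split; [constructor| | |]; intros; contradiction.
  - destruct HT as [(T' & HTT & HT') Hs].
    assert (Hs' := alternates_sign _ _ _ HT'); assert (Hpos := alternates_pos _ _ _ HT').
    destruct (IH T' HT') as (l & Hnd & Hlen & Hl).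
    destruct (IVT_gen g T' T 0 Hg) as (r & Hr & Hgr).
    { simpl in Hs; destruct (Rle_lt_dec (g T') (g T)).
      - rewrite Rmin_left, Rmax_right by assumption; nra.
      - rewrite Rmin_right, Rmax_left by lra; nra. }
    rewrite Rmin_left, Rmax_right in Hr by lra.
    assert (Hr1 : r <> T') by (intros ->; rewrite Hgr in Hs'; lra).
    assert (Hr2 : r <> T) by (intros ->; rewrite Hgr in Hs; lra).
    exists (r :: l); repeat split.
    + constructor; [|exact Hnd]; intros Hin; destruct (Hl r Hin); lra.
    + simpl; rewrite Hlen; reflexivity.
    + destruct H as [<-|H]; [lra|destruct (Hl _ H); lra].
    + destruct H as [<-|H]; [lra|destruct (Hl _ H); lra].
    + destruct H as [<-|H]; [exact Hgr|destruct (Hl _ H); assumption].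
Qed.

(** A version of Rolle's theorem that counts sign changes. Here w g1 is the
    derivative of v g, which has the signs of g. Between two consecutive points
    v g changes sign and so g1 takes the sign of the later one; beyond the last
    point v g returns to 0, which yields one further sign; and g1(0) > 0
    supplies the first. Working with signs rather than zeros avoids any
    discussion of multiplicities. *)
Lemma alternates_derive (g g1 v w : R -> R) (k : nat) (T : R) :
  (forall t, 0 < t -> 0 < v t) -> (forall t, 0 < t -> 0 < w t) ->
  (forall t, 0 < t -> is_derive (fun t => v t * g t) t (w t * g1 t)) ->
  continuity g1 -> 0 < g1 0 ->
  is_lim (fun t => v t * g t) p_infty 0 ->
  alternates g k T -> exists U, alternates g1 (S k) U.
Proof.
  intros Hv Hw Hd Hc H0 Hlim.
  assert (Hmv : forall a b k, 0 < a < b ->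
    0 < (-1) ^ k * (v b * g b - v a * g a) -> exists c, a < c < b /\ 0 < (-1) ^ k * g1 c).
  { intros a b j Hab Hs.
    destruct (mean_value (fun t => v t * g t) (fun t => w t * g1 t) a b) as (c & Hcab & Heq).
    - lra.
    - intros x Hx; apply Hd; lra.
    - exists c; split; [exact Hcab|].
      rewrite Heq in Hs; specialize (Hw c ltac:(lra)).
      replace ((-1) ^ j * (w c * g1 c * (b - a))) with ((w c * (b - a)) * ((-1) ^ j * g1 c)) in Hs by ring.
      assert (0 < w c * (b - a)) by (apply Rmult_lt_0_compat; lra). nra. }
  (* the point found in ]U', U[ lies beyond all the earlier ones since they are
     at most U' *)
  assert (Hshift : forall k T, alternates g k T -> exists U, U <= T /\ alternates g1 k U).
  { induction k0 as [|j IH]; intros U HU.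
    - destruct HU as [HU _].
      destruct (Hc 0 (g1 0) H0) as (d & Hd0 & Hd1).
      exists (Rmin U (d / 2)).
      assert (HS : 0 < Rmin U (d / 2)) by (apply Rmin_glb_lt; lra).
      split; [apply Rmin_l|split; [exact HS|]].
      specialize (Hd1 (Rmin U (d / 2))); simpl in Hd1; unfold R_dist in Hd1.
      assert (H2 : Rabs (g1 (Rmin U (d / 2)) - g1 0) < g1 0).
      { apply Hd1; split; [split; [exact I|lra]|].
        rewrite Rminus_0_r, Rabs_pos_eq by lra.
        apply Rle_lt_trans with (1 := Rmin_r _ _); lra. }
      apply Rabs_def2 in H2; lra.
    - destruct HU as [(U' & HUU & HU') Hs].
      assert (Hs' := alternates_sign _ _ _ HU'); assert (Hpos := alternates_pos _ _ _ HU').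
      destruct (IH U' HU') as (S' & HS' & HaS').
      destruct (Hmv U' U (S j)) as (c & Hc1 & Hc2); [lra| |].
      + assert (Hv1 := Hv U' ltac:(lra)); assert (Hv2 := Hv U ltac:(lra)).
        simpl in Hs |- *; nra.
      + exists c; split; [lra|split; [|exact Hc2]].
        exists S'; split; [lra|exact HaS']. }
  intros HT.
  assert (HTp := alternates_pos _ _ _ HT); assert (HTs := alternates_sign _ _ _ HT).
  destruct (Hshift k T HT) as (S' & HS' & HaS').
  assert (HvT := Hv T HTp).
  assert (Heps : 0 < v T * ((-1) ^ k * g T)) by (apply Rmult_lt_0_compat; lra).
  apply is_lim_spec in Hlim; destruct (Hlim (mkposreal _ Heps)) as [M HM]; simpl in HM.
  set (U := Rmax M T + 1).
  assert (HU1 : M < U) by (unfold U; generalize (Rmax_l M T); lra).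
  assert (HU2 : T < U) by (unfold U; generalize (Rmax_r M T); lra).
  specialize (HM U HU1); rewrite Rminus_0_r in HM.
  destruct (Hmv T U (S k)) as (c & Hc1 & Hc2); [lra| |].
  - assert (Habs : Rabs ((-1) ^ k * (v U * g U)) < v T * ((-1) ^ k * g T)).
    { rewrite Rabs_mult, pow_1_abs, Rmult_1_l; exact HM. }
    apply Rabs_def2 in Habs; simpl; lra.
  - exists c; split; [|exact Hc2]; exists S'; split; [lra|exact HaS'].
Qed.

(** * Real-rootedness of the Laguerre polynomials *)

Lemma is_derive_reflect (f : R -> R) (x l : R) :
  is_derive f (- x) l -> is_derive (fun y => f (- y)) x (- l).
Proof.
  intros Hf; replace (- l) with (scal (-1) l) by (change (-1 * l = - l); ring).
  apply (is_derive_comp f Ropp x l (-1)); [exact Hf|].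
  apply (is_derive_opp (fun y : R => y) x 1), (is_derive_id x).
Qed.

Lemma is_poly_affine n g b s : is_poly n g -> is_poly n (fun x => b * g (s * x)).
Proof.
  revert g b; induction n as [|n IH]; intros g b.
  - intros [c Hc]; exists (b * c); intros x; rewrite Hc; reflexivity.
  - intros (c & h & Hh & Hg); exists (b * c), (fun x => (b * s) * h (s * x)); split.
    + apply IH, Hh.
    + intros x; rewrite Hg; ring.
Qed.

Lemma is_poly_ext n g h : (forall x, g x = h x) -> is_poly n g -> is_poly n h.
Proof.
  destruct n; intros E.
  - intros [c Hc]; exists c; intros x; rewrite <- E; apply Hc.
  - intros (c & q & Hq & Hg); exists c, q; split; [exact Hq|].
    intros x; rewrite <- E; apply Hg.
Qed.

Lemma is_poly_PSeries n a : (forall k, (n < k)%nat -> a k = 0) -> is_poly n (PSeries a).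
Proof.
  revert a; induction n as [|n IH]; intros a Ha.
  - exists (a 0%nat); intros x.
    rewrite PSeries_decr_1 by apply entire_ex_pseries, (entire_finite_support a 0 Ha).
    rewrite (PSeries_ext _ (fun _ => 0)), PSeries_const_0; [ring|].
    intros k; apply Ha; lia.
  - exists (a 0%nat), (PSeries (PS_decr_1 a)); split.
    + apply IH; intros k Hk; apply Ha; lia.
    + intros x; apply PSeries_decr_1, entire_ex_pseries, (entire_finite_support a (S n) Ha).
Qed.

Lemma is_poly_gamma_integrand_lim n g x :
  0 < x -> is_poly n g -> is_lim (fun t => gamma_integrand (x + 1) t * g t) p_infty 0.
Proof.
  revert x g; induction n as [|n IH]; intros x g Hx.
  - intros [c Hc].
    apply (is_lim_ext (fun t => gamma_integrand (x + 1) t * c)).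
    { intros t; rewrite Hc; reflexivity. }
    replace (Finite 0) with (Rbar_mult 0 c) by (simpl; f_equal; ring).
    apply is_lim_scal_r, gamma_boundary_infty, Hx.
  - intros (c & h & Hh & Hg).
    apply (is_lim_ext_loc (fun t => gamma_integrand (x + 1) t * c
                                  + gamma_integrand (x + 1 + 1) t * h t)).
    { exists 0; intros t Ht; rewrite Hg, (gamma_integrand_succ (x + 1)) by exact Ht; ring. }
    replace 0 with (0 * c + 0) by ring.
    apply (is_lim_plus' _ _ p_infty (0 * c) 0).
    + apply (is_lim_scal_r _ c p_infty 0), gamma_boundary_infty, Hx.
    + apply IH; [lra|exact Hh].
Qed.

Fixpoint falling (y : R) (k : nat) : R :=
  match k with
  | O => 1
  | S k' => falling y k' * (y - INR k')
  end.

Lemma falling_nat n k :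
  0 <= falling (INR n) k /\ ((n < k)%nat -> falling (INR n) k = 0).
Proof.
  induction k as [|k [IH1 IH2]]; [split; [simpl; lra|lia]|].
  simpl falling; destruct (Nat.lt_trichotomy n k) as [Hlt|[Heq|Hgt]].
  - rewrite IH2 by exact Hlt; split; [lra|intros _; ring].
  - subst; rewrite Rminus_diag; split; [lra|intros _; ring].
  - split; [|lia]; apply Rmult_le_pos; [exact IH1|]; apply lt_INR in Hgt; lra.
Qed.

Lemma falling_succ y k : falling (y + 1) (S k) = (y + 1) * falling y k.
Proof.
  induction k as [|k IH]; [simpl; ring|].
  change (falling (y + 1) (S k) * (y + 1 - INR (S k)) = (y + 1) * (falling y k * (y - INR k))).
  rewrite IH, S_INR; ring.
Qed.

(** These are the coefficients of the Laguerre polynomial of degree n and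
    parameter mu at -x, normalised to 1 at 0: the falling factorial of n divided
    by k! is the binomial coefficient. *)
Definition laguerre_coef (mu : R) (n k : nat) : R := falling (INR n) k * bcoef mu k.

Definition laguerre (mu : R) (n : nat) : R -> R := PSeries (laguerre_coef mu n).

Lemma laguerre_coef_support mu n k : (n < k)%nat -> laguerre_coef mu n k = 0.
Proof.
  intros Hk; unfold laguerre_coef.
  rewrite (proj2 (falling_nat n k) Hk); apply Rmult_0_l.
Qed.

Lemma entire_laguerre mu n : entire (laguerre_coef mu n).
Proof. apply (entire_finite_support _ n), laguerre_coef_support. Qed.

Lemma laguerre_0 mu n : laguerre mu n 0 = 1.
Proof. unfold laguerre; rewrite PSeries_0; unfold laguerre_coef; simpl; ring. Qed.

(** One step of Rodrigues' formula: it says that t^c e^(-t) L_n(-t), with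
    c = n + mu + 1, has derivative c t^(c-1) e^(-t) L_(n+1)(-t). *)
Lemma laguerre_succ mu n x :
  -1 < mu ->
  (INR n + mu + 1) * laguerre mu (S n) x
  = x * PSeries (PS_derive (laguerre_coef mu n)) x + (INR n + mu + 1 + x) * laguerre mu n x.
Proof.
  intros Hmu; assert (He := entire_laguerre mu n); rewrite (Rmult_plus_distr_r _ x); unfold laguerre.
  assert (Hs : ex_pseries (PS_scal (INR n + mu + 1) (laguerre_coef mu n)) x).
  { apply ex_pseries_scal; [apply Rmult_comm|apply entire_ex_pseries, He]. }
  assert (Hi : ex_pseries (PS_incr_1 (laguerre_coef mu n)) x)
    by apply entire_ex_pseries, entire_incr, He.
  assert (Hd : ex_pseries (PS_incr_1 (PS_derive (laguerre_coef mu n))) x)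
    by apply entire_ex_pseries, entire_incr, entire_derive, He.
  rewrite <- !PSeries_incr_1, <- !PSeries_scal, <- (PSeries_plus _ _ _ Hs Hi),
    <- (PSeries_plus _ _ _ Hd (ex_pseries_plus _ _ _ Hs Hi)).
  apply PSeries_ext; intros [|k].
  - change ((INR n + mu + 1) * (1 * 1) = 0 + ((INR n + mu + 1) * (1 * 1) + 0)); ring.
  - change ((INR n + mu + 1) * laguerre_coef mu (S n) (S k)
            = INR (S k) * laguerre_coef mu n (S k)
              + ((INR n + mu + 1) * laguerre_coef mu n (S k) + laguerre_coef mu n k)).
    unfold laguerre_coef; rewrite (bcoef_rec mu k Hmu), (S_INR n), falling_succ; simpl falling.
    rewrite S_INR; ring.
Qed.

Lemma is_poly_laguerre mu n : is_poly n (fun t => laguerre mu n (- t)).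
Proof.
  apply (is_poly_ext _ (fun t => 1 * laguerre mu n (-1 * t))).
  - intros x; rewrite Rmult_1_l; f_equal; ring.
  - apply is_poly_affine, is_poly_PSeries, laguerre_coef_support.
Qed.

Lemma laguerre_alternates mu n :
  -1 < mu -> exists T, alternates (fun t => laguerre mu n (- t)) n T.
Proof.
  intros Hmu; induction n as [|n [T HT]].
  - exists 1; split; [lra|].
    destruct (is_poly_laguerre mu 0) as [c Hc].
    assert (H0 := Hc 0); rewrite Ropp_0, laguerre_0 in H0.
    rewrite Hc, <- H0; lra.
  - assert (Hc : 0 < INR n + mu + 1) by (generalize (pos_INR n); lra).
    set (c := INR n + mu + 1) in *.
    apply (alternates_derive (fun t => laguerre mu n (- t)) _
             (gamma_integrand (c + 1)) (fun t => c * gamma_integrand c t) n T).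
    + intros t _; apply gamma_integrand_pos.
    + intros t _; apply Rmult_lt_0_compat; [exact Hc|apply gamma_integrand_pos].
    + intros t Ht.
      assert (HL := is_derive_reflect _ _ _ (is_derive_entire _ (- t) (entire_laguerre mu n))).
      evar_last.
      * apply (is_derive_mult (gamma_integrand (c + 1)) (fun t => laguerre mu n (- t)));
          [apply is_derive_gamma_integrand, Ht|exact HL|intros; apply Rmult_comm].
      * unfold plus, mult; simpl.
        replace (c * gamma_integrand c t * laguerre mu (S n) (- t))
          with (gamma_integrand c t * (c * laguerre mu (S n) (- t))) by ring.
        assert (E := laguerre_succ mu n (- t) Hmu); fold c in E.
        rewrite E, gamma_integrand_succ by exact Ht.
        unfold laguerre; ring.
    + intros t; apply (continuity_pt_comp Ropp (laguerre mu (S n))).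
      * apply continuity_pt_opp, continuity_pt_id.
      * apply (is_derive_continuity_pt _ _ (PSeries (PS_derive (laguerre_coef mu (S n))) (- t))).
        apply is_derive_entire, entire_laguerre.
    + rewrite Ropp_0, laguerre_0; lra.
    + apply (is_poly_gamma_integrand_lim n); [exact Hc|apply is_poly_laguerre].
    + exact HT.
Qed.

Lemma laguerre_roots mu n :
  -1 < mu ->
  exists l, NoDup l /\ (forall r, In r l -> 0 < r) /\
    forall t, laguerre mu n (- t) = prod_roots l t.
Proof.
  intros Hmu; destruct (laguerre_alternates mu n Hmu) as [T HT].
  destruct (alternates_roots (fun t => laguerre mu n (- t)) n T) as (l & Hnd & Hlen & Hl);
    [|exact HT|].
  { intros t; apply (continuity_pt_comp Ropp (laguerre mu n)).
    - apply continuity_pt_opp, continuity_pt_id.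
    - apply (is_derive_continuity_pt _ _ (PSeries (PS_derive (laguerre_coef mu n)) (- t))).
      apply is_derive_entire, entire_laguerre. }
  exists l; split; [exact Hnd|split; [intros r Hr; apply Hl, Hr|]].
  intros t; rewrite (is_poly_factor l (fun t => laguerre mu n (- t))).
  - rewrite Ropp_0, laguerre_0; ring.
  - rewrite Hlen; apply is_poly_laguerre.
  - exact Hnd.
  - intros r Hr; destruct (Hl r Hr); split; [lra|assumption].
Qed.

(** * Rescaled Laguerre polynomials as approximants *)

Definition bfun_approx_coef (mu : R) (n k : nat) : R := falling (INR n) k / INR n ^ k * bcoef mu k.

Definition bfun_approx (mu : R) (n : nat) : R -> R := PSeries (bfun_approx_coef mu n).
Definition bfun_approx' (mu : R) (n : nat) : R -> R := PSeries (PS_derive (bfun_approx_coef mu n)).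

Lemma entire_bfun_approx mu n : entire (bfun_approx_coef mu n).
Proof.
  apply (entire_finite_support _ n); intros k Hk; unfold bfun_approx_coef, Rdiv.
  rewrite (proj2 (falling_nat n k) Hk); ring.
Qed.

Lemma bfun_approx_laguerre mu n x : (0 < n)%nat -> bfun_approx mu n x = laguerre mu n (x / INR n).
Proof.
  intros Hn; apply lt_0_INR in Hn.
  apply Series_ext; intros k; unfold bfun_approx_coef, laguerre_coef, Rdiv.
  rewrite Rpow_mult_distr, pow_inv; ring.
Qed.

Lemma bfun_approx_0 mu n : bfun_approx mu n 0 = 1.
Proof. unfold bfun_approx; rewrite PSeries_0; unfold bfun_approx_coef; simpl; field. Qed.

Lemma bfun_approx'_0 mu n : (0 < n)%nat -> bfun_approx' mu n 0 = / (1 + mu).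
Proof.
  intros Hn; apply lt_0_INR in Hn.
  unfold bfun_approx'; rewrite PSeries_0; unfold PS_derive, bfun_approx_coef.
  rewrite <- bfun'_0; unfold bfun'; rewrite PSeries_0; unfold PS_derive.
  replace (falling (INR n) 1 / INR n ^ 1) with 1 by (simpl; field; lra); ring.
Qed.

Lemma is_derive_bfun_approx mu n x : is_derive (bfun_approx mu n) x (bfun_approx' mu n x).
Proof. apply is_derive_entire, entire_bfun_approx. Qed.

(** The ratio of the two coefficients is the product of the 1 - i/n for i < k,
    which differs from 1 by at most (0 + 1 + ... + (k-1))/n <= k^2/n. *)
Lemma bfun_approx_coef_cvg mu n k :
  -1 < mu -> (0 < n)%nat ->
  Rabs (bfun_approx_coef mu n k - bcoef mu k) <= INR k * (INR k * bcoef mu k) / INR n.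
Proof.
  intros Hmu Hn; apply lt_0_INR in Hn.
  assert (Hb := bcoef_pos mu k Hmu).
  set (c := fun k => falling (INR n) k / INR n ^ k).
  assert (Hc : forall k, 0 <= c k <= 1 /\ 1 - c k <= INR k * INR k / INR n).
  { intros j; induction j as [|j [IH1 IH2]].
    - unfold c; simpl; split; [lra|]; unfold Rdiv; lra.
    - assert (Hcj : c (S j) = c j * (1 - INR j / INR n)).
      { unfold c; simpl falling; rewrite <- tech_pow_Rmult; field.
        repeat split; try apply pow_nonzero; lra. }
      assert (H0 : 0 <= c (S j)).
      { apply Rmult_le_pos; [apply falling_nat|].
        left; apply Rinv_0_lt_compat, pow_lt, Hn. }
      assert (Hj := pos_INR j).
      assert (Hjn : 0 <= INR j / INR n) by (apply Rdiv_le_0_compat; lra).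
      rewrite S_INR; split; [split; [exact H0|]|].
      + rewrite Hcj; nra.
      + assert (E : (INR j + 1) * (INR j + 1) / INR n
                    = INR j * INR j / INR n + INR j / INR n + (INR j + 1) / INR n)
          by (field; lra).
        assert (0 <= (INR j + 1) / INR n) by (apply Rdiv_le_0_compat; lra).
        rewrite E, Hcj; nra. }
  destruct (Hc k) as [H1 H2]; unfold bfun_approx_coef; fold (c k).
  replace (c k * bcoef mu k - bcoef mu k) with (- ((1 - c k) * bcoef mu k)) by ring.
  rewrite Rabs_Ropp, Rabs_pos_eq by (apply Rmult_le_pos; lra).
  replace (INR k * (INR k * bcoef mu k) / INR n) with (INR k * INR k / INR n * bcoef mu k)
    by (field; lra).
  apply Rmult_le_compat_r; lra.
Qed.

Lemma bfun_approx_cvg mu : -1 < mu -> cvg_locally_uniform (bfun_approx mu) (bfun mu).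
Proof.
  intros Hmu.
  apply (cvg_locally_uniform_PSeries _ _ (fun k => INR k * (INR k * bcoef mu k))).
  - apply entire_bcoef, Hmu.
  - apply entire_bfun_approx.
  - apply entire_euler, entire_euler, entire_bcoef, Hmu.
  - intros n k Hn; apply bfun_approx_coef_cvg; assumption.
Qed.

Lemma bfun_approx'_cvg mu : -1 < mu -> cvg_locally_uniform (bfun_approx' mu) (bfun' mu).
Proof.
  intros Hmu.
  apply (cvg_locally_uniform_PSeries _ _ (PS_derive (fun k => INR k * (INR k * bcoef mu k)))).
  - apply entire_derive, entire_bcoef, Hmu.
  - intros n; apply entire_derive, entire_bfun_approx.
  - apply entire_derive, entire_euler, entire_euler, entire_bcoef, Hmu.
  - intros n k Hn; unfold PS_derive.
    rewrite <- Rmult_minus_distr_l, Rabs_mult, (Rabs_pos_eq (INR (S k))) by apply pos_INR.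
    unfold Rdiv; rewrite (Rmult_assoc (INR (S k))).
    apply Rmult_le_compat_l; [apply pos_INR|apply bfun_approx_coef_cvg; assumption].
Qed.

Lemma NoDup_map_scale c l : c <> 0 -> NoDup l -> NoDup (map (Rmult c) l).
Proof.
  intros Hc; induction 1 as [|x l Hx Hl IH]; simpl; constructor; [|exact IH].
  intros Hin; apply in_map_iff in Hin; destruct Hin as (y & Hy & Hyl).
  apply Rmult_eq_reg_l in Hy; [congruence|exact Hc].
Qed.

Lemma bfun_approx_roots mu n :
  -1 < mu -> (0 < n)%nat ->
  exists l, NoDup l /\ (forall r, In r l -> 0 < r) /\
    forall t, bfun_approx mu n (- t) = prod_roots l t.
Proof.
  intros Hmu Hn; destruct (laguerre_roots mu n Hmu) as (l & Hnd & Hpos & Hl).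
  assert (Hn0 := lt_0_INR _ Hn).
  exists (map (Rmult (INR n)) l); split; [|split].
  - apply NoDup_map_scale; [lra|exact Hnd].
  - intros r Hr; apply in_map_iff in Hr; destruct Hr as (s & <- & Hs).
    apply Rmult_lt_0_compat; [exact Hn0|apply Hpos, Hs].
  - intros t; rewrite bfun_approx_laguerre by exact Hn.
    replace (- t / INR n) with (- (t / INR n)) by (field; lra); rewrite Hl.
    assert (Hpos' : forall r, In r l -> r <> 0) by (intros r Hr; specialize (Hpos r Hr); lra).
    clear Hl Hnd Hpos; induction l as [|r l IH]; simpl; [reflexivity|].
    rewrite IH by (intros s Hs; apply Hpos'; right; exact Hs).
    assert (Hr : r <> 0) by (apply Hpos'; left; reflexivity).
    f_equal; field; lra.
Qed.

(** * Finite sums over lists *)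

Definition sum_over (f : R -> R) (l : list R) : R := fold_right Rplus 0 (map f l).

Lemma sum_over_cons f x l : sum_over f (x :: l) = f x + sum_over f l.
Proof. reflexivity. Qed.

Lemma sum_over_app f l1 l2 : sum_over f (l1 ++ l2) = sum_over f l1 + sum_over f l2.
Proof.
  induction l1 as [|x l IH]; simpl; [unfold sum_over; simpl; ring|].
  rewrite !sum_over_cons, IH; ring.
Qed.

Lemma sum_over_le f g l : (forall x, In x l -> f x <= g x) -> sum_over f l <= sum_over g l.
Proof.
  induction l as [|x l IH]; intros H; [right; reflexivity|].
  rewrite !sum_over_cons; apply Rplus_le_compat; [apply H; left; reflexivity|].
  apply IH; intros y Hy; apply H; right; exact Hy.
Qed.

Lemma sum_over_ext f g l : (forall x, In x l -> f x = g x) -> sum_over f l = sum_over g l.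
Proof.
  intros H; apply Rle_antisym; apply sum_over_le; intros x Hx; rewrite (H x Hx); lra.
Qed.

Lemma sum_over_plus f g l : sum_over (fun x => f x + g x) l = sum_over f l + sum_over g l.
Proof.
  induction l as [|x l IH]; [unfold sum_over; simpl; ring|].
  rewrite !sum_over_cons, IH; ring.
Qed.

Lemma sum_over_scal c f l : sum_over (fun x => c * f x) l = c * sum_over f l.
Proof.
  induction l as [|x l IH]; [unfold sum_over; simpl; ring|].
  rewrite !sum_over_cons, IH; ring.
Qed.

Lemma sum_over_minus f g l : sum_over (fun x => f x - g x) l = sum_over f l - sum_over g l.
Proof.
  rewrite (sum_over_ext _ (fun x => f x + -1 * g x)) by (intros; ring).
  rewrite sum_over_plus, sum_over_scal; ring.
Qed.

Lemma sum_over_const c l : sum_over (fun _ => c) l = INR (length l) * c.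
Proof.
  induction l as [|x l IH]; [unfold sum_over; simpl; ring|].
  rewrite sum_over_cons, IH; simpl length; rewrite S_INR; ring.
Qed.

Lemma sum_over_0 f l : (forall x, In x l -> f x = 0) -> sum_over f l = 0.
Proof.
  intros H; rewrite (sum_over_ext f (fun _ => 0)), sum_over_const by exact H; ring.
Qed.

Lemma sum_over_nonneg f l : (forall x, In x l -> 0 <= f x) -> 0 <= sum_over f l.
Proof.
  intros H; rewrite <- (sum_over_0 (fun _ => 0) l) by reflexivity; apply sum_over_le, H.
Qed.

Lemma sum_over_single f l y :
  NoDup l -> In y l -> (forall x, In x l -> x <> y -> f x = 0) -> sum_over f l = f y.
Proof.
  induction 1 as [|x l Hx Hl IH]; intros Hy H0; [contradiction|].
  rewrite sum_over_cons; destruct Hy as [->|Hy].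
  - rewrite sum_over_0; [ring|].
    intros z Hz; apply H0; [right; exact Hz|congruence].
  - rewrite IH, H0; [ring|left; reflexivity|congruence|exact Hy|].
    intros z Hz; apply H0; right; exact Hz.
Qed.

Lemma sum_over_perm f l1 l2 : Permutation l1 l2 -> sum_over f l1 = sum_over f l2.
Proof.
  induction 1; rewrite ?sum_over_cons; try congruence; ring.
Qed.

Lemma sum_over_same_elements f l1 l2 :
  NoDup l1 -> NoDup l2 -> (forall x, In x l1 <-> In x l2) -> sum_over f l1 = sum_over f l2.
Proof. intros; apply sum_over_perm, NoDup_Permutation; assumption. Qed.

Definition window (a b : R) (h : R -> R) (z : R) : R :=
  if Rlt_dec a z then if Rlt_dec z b then h z else 0 else 0.

Lemma window_in a b h z : a < z < b -> window a b h z = h z.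
Proof.
  intros Hz; unfold window; destruct (Rlt_dec a z), (Rlt_dec z b); lra.
Qed.

Lemma window_out a b h z : ~ (a < z < b) -> window a b h z = 0.
Proof.
  intros Hz; unfold window; destruct (Rlt_dec a z), (Rlt_dec z b); lra.
Qed.

Lemma window_split a b c h z :
  a <= b <= c -> z <> b -> window a c h z = window a b h z + window b c h z.
Proof.
  intros Hb Hz; unfold window.
  destruct (Rlt_dec a z), (Rlt_dec z c), (Rlt_dec z b), (Rlt_dec b z); lra.
Qed.

(** * Convergence of zeros *)

(** Near a point where the limit is nonzero, the approximating functions
    eventually have the sign of the limit. Applied to functions, it excludes
    zeros; applied to derivatives, it makes zeros unique. *)
Lemma cvg_locally_uniform_sign (g_ : nat -> R -> R) (g : R -> R) (y : R) :
  cvg_locally_uniform g_ g -> continuity_pt g y -> g y <> 0 ->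
  exists d N, 0 < d /\ forall x, Rabs (x - y) < d ->
    0 < g y * g x /\ forall n, (N <= n)%nat -> 0 < g y * g_ n x.
Proof.
  intros Hcv Hc Hy.
  assert (Heps : 0 < Rabs (g y) / 2) by (apply Rabs_pos_lt in Hy; lra).
  destruct (Hc _ Heps) as (d & Hd & Hnear).
  destruct (Hcv (Rabs y + d) _ Heps) as [N HN].
  exists d, N; split; [exact Hd|]; intros x Hx.
  assert (H1 : Rabs (g x - g y) < Rabs (g y) / 2).
  { destruct (Req_dec x y) as [->|Hxy]; [rewrite Rminus_diag, Rabs_R0; exact Heps|].
    apply (Hnear x); split; [split; [exact I|congruence]|exact Hx]. }
  assert (Hpos : forall u, Rabs (u - g y) < Rabs (g y) -> 0 < g y * u).
  { intros u Hu; destruct (Rle_dec 0 (g y)).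
    - rewrite (Rabs_pos_eq (g y)) in Hu by lra; apply Rabs_def2 in Hu; nra.
    - rewrite (Rabs_left (g y)) in Hu by lra; apply Rabs_def2 in Hu; nra. }
  split; [apply Hpos; lra|]; intros n Hn; apply Hpos.
  assert (H2 : Rabs (g_ n x - g x) < Rabs (g y) / 2).
  { apply HN; [exact Hn|].
    replace x with (y + (x - y)) by ring.
    apply Rle_trans with (1 := Rabs_triang _ _); lra. }
  replace (g_ n x - g y) with ((g_ n x - g x) + (g x - g y)) by ring.
  apply Rle_lt_trans with (1 := Rabs_triang _ _); lra.
Qed.

(** The data of the real Hurwitz theorem: smooth functions g_ n with finitely
    many positive zeros, listed by Z n, tending together with their derivatives
    to a function g whose zeros are simple. The index 0 is excluded because the
    approximants rescale by 1/n. *)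
Record zero_approximation (g g' : R -> R) (g_ g_' : nat -> R -> R)
    (Z : nat -> list R) : Prop := {
  za_derive : forall x, is_derive g x (g' x);
  za_continuous' : forall x, continuity_pt g' x;
  za_derive_ : forall n x, is_derive (g_ n) x (g_' n x);
  za_cvg : cvg_locally_uniform g_ g;
  za_cvg' : cvg_locally_uniform g_' g';
  za_simple : forall x, g x = 0 -> g' x <> 0;
  za_NoDup : forall n, NoDup (Z n);
  za_roots : forall n, (0 < n)%nat -> forall x, In x (Z n) <-> 0 < x /\ g_ n x = 0
}.

(** Convergence of the zeros in an open interval, tested against continuous
    functions: the counting measures of the zeros converge to that of the limit.
    Stated in this way it is additive in the interval. *)
Definition zeros_cvg (g : R -> R) (Z : nat -> list R) (a b : R) : Prop :=
  exists L, NoDup L /\ (forall w, In w L <-> a < w < b /\ g w = 0) /\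
    forall h, (forall w, 0 < w -> continuity_pt h w) ->
      is_lim_seq (fun n => sum_over (window a b h) (Z n)) (sum_over h L).

Lemma zeros_cvg_chain g g' g_ g_' Z a b c :
  zero_approximation g g' g_ g_' Z -> a <= b <= c -> g b <> 0 ->
  zeros_cvg g Z a b -> zeros_cvg g Z b c -> zeros_cvg g Z a c.
Proof.
  intros HZ Hb Hgb (L1 & Hnd1 & HL1 & H1) (L2 & Hnd2 & HL2 & H2).
  exists (L1 ++ L2); split; [|split].
  - apply NoDup_app; [exact Hnd1|exact Hnd2|].
    intros w Hw1 Hw2; apply HL1 in Hw1; apply HL2 in Hw2; lra.
  - intros w; rewrite in_app_iff, HL1, HL2; split; [lra|].
    intros [Hw Hgw]; destruct (Rtotal_order w b) as [Hlt|[->|Hgt]]; [lra|contradiction|lra].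
  - intros h Hh; rewrite sum_over_app.
    apply (is_lim_seq_ext_loc (fun n => sum_over (window a b h) (Z n) + sum_over (window b c h) (Z n))).
    + destruct (cvg_locally_uniform_sign g_ g b) as (d & N & Hd & HN).
      * apply (za_cvg _ _ _ _ _ HZ).
      * apply (is_derive_continuity_pt _ _ _ (za_derive _ _ _ _ _ HZ b)).
      * exact Hgb.
      * exists (S N); intros n Hn; rewrite <- sum_over_plus.
        apply sum_over_ext; intros z Hz; symmetry; apply window_split; [exact Hb|].
        intros ->; apply (za_roots _ _ _ _ _ HZ) in Hz; [|lia].
        destruct (HN b) as [_ HNb]; [rewrite Rminus_diag, Rabs_R0; exact Hd|].
        specialize (HNb n ltac:(lia)); rewrite (proj2 Hz) in HNb; lra.
    + apply is_lim_seq_plus'; auto.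
Qed.

(** Near a zero y of the limit, the derivatives have a constant sign, so that
    the functions are strictly monotone: g_ n has exactly one zero there, and it
    lies in every given neighbourhood of y once n is large. Near other points
    there are eventually none. *)
Lemma zeros_cvg_local g g' g_ g_' Z y :
  zero_approximation g g' g_ g_' Z ->
  exists d, 0 < d /\ (forall x, y < x < y + d -> g x <> 0) /\
    forall a b, 0 <= a -> y - d < a <= y -> y <= b < y + d ->
      g a <> 0 -> g b <> 0 -> zeros_cvg g Z a b.
Proof.
  intros HZ.
  assert (Hcont : forall x, continuity_pt g x)
    by (intros x; apply (is_derive_continuity_pt _ _ _ (za_derive _ _ _ _ _ HZ x))).
  assert (Hcv := za_cvg _ _ _ _ _ HZ).
  destruct (Req_dec (g y) 0) as [Hy|Hy].
  - assert (Hy' := za_simple _ _ _ _ _ HZ y Hy).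
    destruct (cvg_locally_uniform_sign g_' g' y) as (d & N & Hd & HN);
      [apply (za_cvg' _ _ _ _ _ HZ)|apply (za_continuous' _ _ _ _ _ HZ)|exact Hy'|].
    assert (Hincr : forall u v, y - d < u < v -> v < y + d -> 0 < g' y * (g v - g u)).
    { intros u v Huv Hv; destruct (mean_value g g' u v) as (c & Hc & E); [lra| |].
      - intros x _; apply (za_derive _ _ _ _ _ HZ).
      - destruct (HN c) as [H _]; [apply Rabs_def1; lra|].
        rewrite E, <- Rmult_assoc; apply Rmult_lt_0_compat; lra. }
    assert (Hincr_ : forall n u v, (N <= n)%nat -> y - d < u < v -> v < y + d ->
                        0 < g' y * (g_ n v - g_ n u)).
    { intros n u v Hn Huv Hv; destruct (mean_value (g_ n) (g_' n) u v) as (c & Hc & E); [lra| |].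
      - intros x _; apply (za_derive_ _ _ _ _ _ HZ).
      - destruct (HN c) as [_ H]; [apply Rabs_def1; lra|].
        rewrite E, <- Rmult_assoc; apply Rmult_lt_0_compat; [apply H, Hn|lra]. }
    assert (Huniq : forall n u v, (N <= n)%nat -> y - d < u < y + d -> y - d < v < y + d ->
                        g_ n u = 0 -> g_ n v = 0 -> u = v).
    { intros n u v Hn Hu Hv Eu Ev; destruct (Rtotal_order u v) as [H|[H|H]]; [|exact H|].
      - specialize (Hincr_ n u v Hn ltac:(lra) ltac:(lra)); rewrite Eu, Ev in Hincr_; lra.
      - specialize (Hincr_ n v u Hn ltac:(lra) ltac:(lra)); rewrite Eu, Ev in Hincr_; lra. }
    assert (Hiso : forall x, y - d < x < y + d -> x <> y -> g x <> 0).
    { intros x Hx Hxy E; destruct (Rtotal_order x y) as [H|[H|H]]; [|contradiction|].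
      - specialize (Hincr x y ltac:(lra) ltac:(lra)); rewrite E, Hy in Hincr; lra.
      - specialize (Hincr y x ltac:(lra) ltac:(lra)); rewrite E, Hy in Hincr; lra. }
    assert (Hexists : forall a b, y - d < a < y -> y < b < y + d ->
              exists N', forall n, (N' <= n)%nat -> exists z, a < z < b /\ g_ n z = 0).
    { intros a b Ha Hb.
      assert (Hga := Hincr a y ltac:(lra) ltac:(lra)); rewrite Hy in Hga.
      assert (Hgb := Hincr y b ltac:(lra) ltac:(lra)); rewrite Hy in Hgb.
      destruct (cvg_locally_uniform_sign g_ g a Hcv (Hcont a)) as (da & Na & Hda & HNa);
        [apply Hiso; lra|].
      destruct (cvg_locally_uniform_sign g_ g b Hcv (Hcont b)) as (db & Nb & Hdb & HNb);
        [apply Hiso; lra|].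
      exists (Na + Nb)%nat; intros n Hn.
      destruct (HNa a) as [_ H1]; [rewrite Rminus_diag, Rabs_R0; exact Hda|].
      destruct (HNb b) as [_ H2]; [rewrite Rminus_diag, Rabs_R0; exact Hdb|].
      specialize (H1 n ltac:(lia)); specialize (H2 n ltac:(lia)).
      assert (H3 : g_ n a * g_ n b < 0).
      { assert (Hgab : g a * g b < 0) by nra.
        assert (0 < (g a * g_ n a) * (g b * g_ n b)) by (apply Rmult_lt_0_compat; lra). nra. }
      destruct (IVT_gen (g_ n) a b 0) as (z & Hz & Ez).
      + intros x; apply (is_derive_continuity_pt _ _ _ (za_derive_ _ _ _ _ _ HZ n x)).
      + unfold Rmin, Rmax; destruct (Rle_dec (g_ n a) (g_ n b)); nra.
      + rewrite Rmin_left, Rmax_right in Hz by lra.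
        assert (z <> a) by (intros ->; rewrite Ez in H3; lra).
        assert (z <> b) by (intros ->; rewrite Ez in H3; lra).
        exists z; split; [lra|exact Ez]. }
    exists d; split; [exact Hd|split].
    { intros x Hx; apply Hiso; lra. }
    intros a b Ha0 Ha Hb Hga Hgb.
    assert (Hay : a <> y) by congruence; assert (Hby : b <> y) by congruence.
    exists (y :: nil); split; [|split].
    + constructor; [intros []|constructor].
    + intros w; split.
      * intros [<-|[]]; split; [lra|exact Hy].
      * intros [Hw Ew]; left; destruct (Req_dec w y) as [E|E]; [congruence|].
        destruct (Hiso w ltac:(lra) E Ew).
    + intros h Hh; apply is_lim_seq_spec; intros eps.
      destruct (Hh y ltac:(lra) eps (cond_pos eps)) as (eta & Heta & Hnear).
      destruct (Hexists (Rmax a (y - eta)) (Rmin b (y + eta))) as (N' & HN').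
      { split; [apply Rlt_le_trans with (2 := Rmax_l _ _)|apply Rmax_lub_lt]; lra. }
      { split; [apply Rmin_glb_lt|apply Rle_lt_trans with (1 := Rmin_l _ _)]; lra. }
      exists (S (N + N')); intros n Hn.
      destruct (HN' n ltac:(lia)) as (z & Hz & Ez).
      assert (Haz : a < z < b /\ y - eta < z < y + eta).
      { generalize (Rmax_l a (y - eta)), (Rmax_r a (y - eta)),
          (Rmin_l b (y + eta)), (Rmin_r b (y + eta)); lra. }
      rewrite (sum_over_single _ _ z).
      * rewrite window_in, sum_over_cons by tauto; unfold sum_over; simpl; rewrite Rplus_0_r.
        destruct (Req_dec z y) as [->|Hzy]; [rewrite Rminus_diag, Rabs_R0; apply cond_pos|].
        apply (Hnear z); split; [split; [exact I|congruence]|].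
        simpl; unfold R_dist; apply Rabs_def1; lra.
      * apply (za_NoDup _ _ _ _ _ HZ).
      * apply (za_roots _ _ _ _ _ HZ); [lia|split; [lra|exact Ez]].
      * intros x Hx Hxz; apply (za_roots _ _ _ _ _ HZ) in Hx; [|lia].
        apply window_out; intros Hxab; apply Hxz.
        apply (Huniq n); [lia|lra|lra|apply Hx|exact Ez].
  - destruct (cvg_locally_uniform_sign g_ g y Hcv (Hcont y) Hy) as (d & N & Hd & HN).
    assert (Hg : forall x, y - d < x < y + d -> g x <> 0).
    { intros x Hx E; destruct (HN x) as [H _]; [apply Rabs_def1; lra|].
      rewrite E in H; lra. }
    exists d; split; [exact Hd|split; [intros x Hx; apply Hg; lra|]].
    intros a b Ha0 Ha Hb _ _; exists nil; split; [constructor|split].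
    + intros w; split; [intros []|intros [Hw Ew]; destruct (Hg w ltac:(lra) Ew)].
    + intros h _; apply (is_lim_seq_ext_loc (fun _ => 0)); [|apply is_lim_seq_const].
      exists (S N); intros n Hn; symmetry; apply sum_over_0; intros x Hx.
      apply (za_roots _ _ _ _ _ HZ) in Hx; [|lia].
      apply window_out; intros Hxab.
      destruct (HN x) as [_ H]; [apply Rabs_def1; lra|].
      specialize (H n ltac:(lia)); rewrite (proj2 Hx) in H; lra.
Qed.

(** Local convergence propagates along [0, M]: the supremum of the points that
    can be reached is M, since zeros are isolated and the local statement
    overlaps it on both sides. *)
Lemma zeros_cvg_global g g' g_ g_' Z M :
  zero_approximation g g' g_ g_' Z -> g 0 <> 0 -> 0 <= M -> g M <> 0 ->
  zeros_cvg g Z 0 M.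
Proof.
  intros HZ H0 HM HgM.
  set (E := fun t => 0 <= t <= M /\ g t <> 0 /\ zeros_cvg g Z 0 t).
  assert (HE0 : E 0).
  { split; [lra|split; [exact H0|]].
    exists nil; split; [constructor|split].
    - intros w; split; [intros []|lra].
    - intros h _; apply (is_lim_seq_ext (fun _ => 0)); [|apply is_lim_seq_const].
      intros n; symmetry; apply sum_over_0; intros x _; apply window_out; lra. }
  destruct (completeness E) as [y [Hub Hlub]].
  { exists M; intros t [Ht _]; lra. }
  { exists 0; exact HE0. }
  assert (Hy : 0 <= y <= M) by (split; [apply Hub, HE0|apply Hlub; intros t [Ht _]; lra]).
  destruct (zeros_cvg_local _ _ _ _ _ y HZ) as (d & Hd & Hiso & Hloc).
  assert (Ht : exists t, E t /\ y - d < t).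
  { apply NNPP; intros Hn; assert (y <= y - d); [|lra].
    apply Hlub; intros t Ht; apply Rnot_lt_le; intros Hlt; apply Hn; exists t; auto. }
  destruct Ht as (t & HEt & Hty); assert (Hty' := Hub t HEt).
  destruct HEt as (Ht & Hgt & Hcvt).
  set (b := Rmin (y + d / 2) M).
  assert (Hb : y <= b < y + d /\ b <= M /\ (b = M \/ y < b)).
  { unfold b, Rmin; destruct (Rle_dec (y + d / 2) M); lra. }
  assert (Hgb : g b <> 0).
  { destruct (proj2 (proj2 Hb)) as [->|H]; [exact HgM|apply Hiso; lra]. }
  assert (HEb : E b).
  { split; [lra|split; [exact Hgb|]].
    apply (zeros_cvg_chain _ _ _ _ _ 0 t b HZ); [lra|exact Hgt|exact Hcvt|].
    apply Hloc; [lra|lra|lra|exact Hgt|exact Hgb]. }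
  assert (Hby := Hub b HEb).
  destruct (proj2 (proj2 Hb)) as [E1|H]; [|lra].
  rewrite <- E1; apply HEb.
Qed.

(** * The zeros of the entire function below a bound *)

Lemma prod_roots_eq_0 l t :
  (forall r, In r l -> 0 < r) -> (prod_roots l t = 0 <-> In t l).
Proof.
  induction l as [|r l IH]; intros Hl; simpl; [split; [lra|intros []]|].
  assert (Hr : 0 < r) by (apply Hl; left; reflexivity).
  specialize (IH (fun s Hs => Hl s (or_intror Hs))).
  split.
  - intros H; apply Rmult_integral in H; destruct H as [H|H]; [left|right; apply IH, H].
    apply (f_equal (Rmult r)) in H; replace (r * (1 - t / r)) with (r - t) in H by (field; lra).
    lra.
  - intros [->|H]; [field; lra|rewrite (proj2 IH H); ring].
Qed.

Lemma prod_roots_neg_ge_1 l x :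
  (forall r, In r l -> 0 < r) -> 0 <= x -> 1 <= prod_roots l (- x).
Proof.
  intros Hl Hx; induction l as [|r l IH]; simpl; [lra|].
  assert (Hr : 0 < r) by (apply Hl; left; reflexivity).
  specialize (IH (fun s Hs => Hl s (or_intror Hs))).
  assert (0 <= x / r) by (apply Rdiv_le_0_compat; lra).
  replace (- x / r) with (- (x / r)) by (field; lra); nra.
Qed.

Lemma is_derive_prod_roots_neg l x :
  (forall r, In r l -> 0 < r) -> 0 <= x ->
  is_derive (fun x => prod_roots l (- x)) x
    (prod_roots l (- x) * sum_over (fun r => / (r + x)) l).
Proof.
  intros Hl Hx; induction l as [|r l IH].
  - replace (_ * _) with 0 by (unfold sum_over; simpl; ring).
    apply (is_derive_const (V := R_NormedModule) 1 x).
  - assert (Hr : 0 < r) by (apply Hl; left; reflexivity).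
    specialize (IH (fun s Hs => Hl s (or_intror Hs))).
    evar_last.
    + apply (is_derive_mult (fun x => 1 - - x / r) (fun x => prod_roots l (- x)) x (/ r));
        [|exact IH|intros; apply Rmult_comm].
      auto_derive; [trivial|field; lra].
    + rewrite sum_over_cons.
      change (/ r * prod_roots l (- x)
        + (1 - - x / r) * (prod_roots l (- x) * sum_over (fun r => / (r + x)) l)
        = (1 - - x / r) * prod_roots l (- x)
          * (/ (r + x) + sum_over (fun r => / (r + x)) l)).
      field; lra.
Qed.

Lemma bfun_approx_log_derivative mu n l x :
  (forall r, In r l -> 0 < r) -> (forall t, bfun_approx mu n (- t) = prod_roots l t) -> 0 <= x ->
  0 < bfun_approx mu n x /\ bfun_approx' mu n x / bfun_approx mu n x = sum_over (fun r => / (r + x)) l.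
Proof.
  intros Hl Heq Hx.
  assert (Hfun : forall y, bfun_approx mu n y = prod_roots l (- y))
    by (intros y; rewrite <- Heq, Ropp_involutive; reflexivity).
  assert (Hge := prod_roots_neg_ge_1 l x Hl Hx).
  assert (Hd : bfun_approx' mu n x = prod_roots l (- x) * sum_over (fun r => / (r + x)) l).
  { rewrite <- (is_derive_unique _ _ _ (is_derive_bfun_approx mu n x)).
    apply is_derive_unique.
    apply (is_derive_ext (fun x => prod_roots l (- x))); [intros y; symmetry; apply Hfun|].
    apply is_derive_prod_roots_neg; assumption. }
  rewrite Hd, Hfun; split; [lra|field; lra].
Qed.

Lemma cvg_locally_uniform_pointwise g_ g x :
  cvg_locally_uniform g_ g -> is_lim_seq (fun n => g_ n x) (g x).
Proof.
  intros H; apply is_lim_seq_spec; intros eps.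
  destruct (H (Rabs x) eps (cond_pos eps)) as [N HN].
  exists N; intros n Hn; apply HN; [exact Hn|lra].
Qed.

Lemma cvg_locally_uniform_reflect g_ g :
  cvg_locally_uniform g_ g ->
  cvg_locally_uniform (fun n x => g_ n (- x)) (fun x => g (- x)).
Proof.
  intros H X eps Heps; destruct (H X eps Heps) as [N HN].
  exists N; intros n Hn x Hx; apply HN; [exact Hn|rewrite Rabs_Ropp; exact Hx].
Qed.

Lemma cvg_locally_uniform_opp g_ g :
  cvg_locally_uniform g_ g ->
  cvg_locally_uniform (fun n x => - g_ n x) (fun x => - g x).
Proof.
  intros H X eps Heps; destruct (H X eps Heps) as [N HN].
  exists N; intros n Hn x Hx.
  replace (- g_ n x - - g x) with (- (g_ n x - g x)) by ring.
  rewrite Rabs_Ropp; apply HN; assumption.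
Qed.

Lemma bfun_zero_pos mu t : -1 < mu -> bfun mu (- t) = 0 -> 0 < t.
Proof.
  intros Hmu H; apply Rnot_le_lt; intros Ht.
  assert (0 < bfun mu (- t)) by (apply bfun_pos; lra); lra.
Qed.

Lemma bfun_zero_approximation mu :
  -1 < mu ->
  exists Z,
    zero_approximation (fun t => bfun mu (- t)) (fun t => - bfun' mu (- t))
      (fun n t => bfun_approx mu n (- t)) (fun n t => - bfun_approx' mu n (- t)) Z /\
    forall n, (0 < n)%nat ->
      (forall r, In r (Z n) -> 0 < r) /\ forall t, bfun_approx mu n (- t) = prod_roots (Z n) t.
Proof.
  intros Hmu.
  assert (Hex : forall n, exists l, NoDup l /\ ((0 < n)%nat ->
      (forall r, In r l -> 0 < r) /\ forall t, bfun_approx mu n (- t) = prod_roots l t)).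
  { intros [|n]; [exists nil; split; [constructor|lia]|].
    destruct (bfun_approx_roots mu (S n) Hmu) as (l & H1 & H2 & H3); [lia|].
    exists l; auto. }
  set (Z := fun n => proj1_sig (constructive_indefinite_description _ (Hex n))).
  assert (HZ : forall n, NoDup (Z n) /\ ((0 < n)%nat ->
      (forall r, In r (Z n) -> 0 < r) /\ forall t, bfun_approx mu n (- t) = prod_roots (Z n) t))
    by (intros n; unfold Z; destruct (constructive_indefinite_description _ (Hex n)); assumption).
  exists Z; split; [|intros n Hn; apply HZ, Hn].
  constructor.
  - intros x; apply is_derive_reflect, is_derive_bfun, Hmu.
  - intros x; apply (is_derive_continuity_pt _ _ (- - bfun'' mu (- x))).
    apply (is_derive_opp (fun t => bfun' mu (- t)) x (- bfun'' mu (- x))).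
    apply is_derive_reflect, is_derive_bfun', Hmu.
  - intros n x; apply is_derive_reflect, is_derive_bfun_approx.
  - apply cvg_locally_uniform_reflect, bfun_approx_cvg, Hmu.
  - apply (cvg_locally_uniform_opp (fun n x => bfun_approx' mu n (- x))
             (fun x => bfun' mu (- x))), cvg_locally_uniform_reflect, bfun_approx'_cvg, Hmu.
  - intros x Hx; assert (Hx0 := bfun_zero_pos mu x Hmu Hx).
    assert (H := bfun_simple_zeros mu (- x) Hmu ltac:(lra) Hx); lra.
  - intros n; apply HZ.
  - intros n Hn x; destruct (HZ n) as [_ H]; destruct (H Hn) as [Hpos Heq].
    rewrite Heq, prod_roots_eq_0 by exact Hpos.
    split; [intros Hx; split; [apply Hpos, Hx|exact Hx]|tauto].
Qed.

(** The limit of the identities satisfied by the approximants. The sum of all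
    the 1/r is 1/(1 + mu) for each of them, which bounds the contribution
    of the zeros beyond M uniformly. *)
Lemma bfun_zeros_below mu M :
  -1 < mu -> 0 < M -> bfun mu (- M) <> 0 ->
  exists L, NoDup L /\ (forall w, In w L <-> 0 < w < M /\ bfun mu (- w) = 0) /\
    sum_over Rinv L <= / (1 + mu) /\
    forall x, 0 < x ->
      Rabs (/ (1 + mu) - bfun' mu x / bfun mu x - sum_over (fun r => / r - / (r + x)) L)
      <= x / M * / (1 + mu).
Proof.
  intros Hmu HM HgM.
  destruct (bfun_zero_approximation mu Hmu) as (Z & HZ & Hprod).
  destruct (zeros_cvg_global _ _ _ _ _ M HZ) as (L & Hnd & HL & Hlim).
  { rewrite Ropp_0, bfun_0; lra. }
  { lra. }
  { exact HgM. }
  assert (Hinv : forall n, (0 < n)%nat -> sum_over Rinv (Z n) = / (1 + mu)).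
  { intros n Hn; destruct (Hprod n Hn) as [Hpos Heq].
    destruct (bfun_approx_log_derivative mu n (Z n) 0 Hpos Heq) as [_ H]; [lra|].
    rewrite bfun_approx'_0, bfun_approx_0, Rdiv_1_r in H by exact Hn; rewrite H.
    apply sum_over_ext; intros; rewrite Rplus_0_r; reflexivity. }
  assert (Hwin : forall h n, (0 < n)%nat -> (forall r, 0 < r -> 0 <= h r) ->
            forall r, In r (Z n) -> 0 <= window 0 M h r <= h r).
  { intros h n Hn Hh r Hr; assert (Hr0 : 0 < r) by (apply (Hprod n Hn), Hr).
    specialize (Hh r Hr0); destruct (Rlt_dec r M).
    - rewrite window_in by lra; lra.
    - rewrite window_out by lra; lra. }
  exists L; split; [exact Hnd|split; [|split]].
  - exact HL.
  - apply (is_lim_seq_le_loc (fun n => sum_over (window 0 M Rinv) (Z n)) (fun _ => / (1 + mu))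
             (sum_over Rinv L) (/ (1 + mu))).
    + exists 1%nat; intros n Hn; rewrite <- (Hinv n) by lia.
      apply sum_over_le; intros r Hr; apply (Hwin _ n); [lia| |exact Hr].
      intros s Hs; left; apply Rinv_0_lt_compat, Hs.
    + apply Hlim; intros w Hw; apply (is_derive_continuity_pt _ _ (- / w ^ 2)).
      auto_derive; [lra|field; lra].
    + apply is_lim_seq_const.
  - intros x Hx; set (h := fun r => / r - / (r + x)).
    assert (Hh : forall r, 0 < r -> h r = x / (r * (r + x))) by (intros r Hr; unfold h; field; lra).
    assert (Hh0 : forall r, 0 < r -> 0 <= h r).
    { intros r Hr; rewrite Hh by exact Hr.
      apply Rdiv_le_0_compat; [lra|apply Rmult_lt_0_compat; lra]. }
    assert (Hcv : is_lim_seq (fun n => Rabs (/ (1 + mu) - bfun_approx' mu n x / bfun_approx mu n x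
                     - sum_over (window 0 M h) (Z n)))
              (Rabs (/ (1 + mu) - bfun' mu x / bfun mu x - sum_over h L))).
    { apply (is_lim_seq_abs _ (Finite _)), is_lim_seq_minus'; [apply is_lim_seq_minus'|].
      - apply is_lim_seq_const.
      - apply is_lim_seq_div'.
        + apply (cvg_locally_uniform_pointwise _ _ x (bfun_approx'_cvg mu Hmu)).
        + apply (cvg_locally_uniform_pointwise _ _ x (bfun_approx_cvg mu Hmu)).
        + assert (H := bfun_pos mu x Hmu ltac:(lra)); lra.
      - apply Hlim; intros w Hw.
        apply (is_derive_continuity_pt _ _ (- / w ^ 2 + / (w + x) ^ 2)).
        unfold h; auto_derive; [lra|field; lra]. }
    apply (is_lim_seq_le_loc _ (fun _ => x / M * / (1 + mu)) _ (x / M * / (1 + mu)))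
      with (2 := Hcv); [|apply is_lim_seq_const].
    exists 1%nat; intros n Hn; destruct (Hprod n ltac:(lia)) as [Hpos Heq].
    destruct (bfun_approx_log_derivative mu n (Z n) x Hpos Heq) as [_ H]; [lra|].
    rewrite H, <- (Hinv n), <- !sum_over_minus by lia.
    rewrite Rabs_pos_eq.
    + rewrite <- sum_over_scal; apply sum_over_le; intros r Hr.
      assert (Hr0 := Hpos r Hr).
      destruct (Rlt_dec r M).
      * rewrite window_in by lra; fold (h r).
        assert (0 < x / M * / r); [|lra].
        apply Rmult_lt_0_compat; [apply Rdiv_lt_0_compat; lra|apply Rinv_0_lt_compat; lra].
      * rewrite window_out, Rminus_0_r by lra; fold (h r).
        rewrite Hh by exact Hr0.
        replace (x / (r * (r + x))) with (x * / r * / (r + x)) by (field; lra).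
        replace (x / M * / r) with (x * / r * / M) by (field; lra).
        apply Rmult_le_compat_l.
        -- apply Rmult_le_pos; [lra|left; apply Rinv_0_lt_compat, Hr0].
        -- apply Rinv_le_contravar; lra.
    + apply sum_over_nonneg; intros r Hr.
      destruct (Hwin h n ltac:(lia) Hh0 r Hr) as [_ H2]; fold (h r); lra.
Qed.

Lemma bfun_log_derivative_le mu x :
  -1 / 2 <= mu -> 0 < x -> (bfun' mu x / bfun mu x) ^ 2 <= / x.
Proof.
  intros Hmu Hx; assert (H := bfun'_le_bfun mu x Hmu Hx).
  assert (Hb : 0 < bfun mu x) by (apply bfun_pos; lra).
  replace ((bfun' mu x / bfun mu x) ^ 2) with (x * bfun' mu x ^ 2 * / bfun mu x ^ 2 * / x)
    by (field; lra).
  rewrite <- (Rmult_1_l (/ x)) at 2.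
  apply Rmult_le_compat_r; [left; apply Rinv_0_lt_compat, Hx|].
  assert (Hb2 : 0 < bfun mu x ^ 2) by (apply pow_lt, Hb).
  rewrite <- (Rinv_r (bfun mu x ^ 2)) by lra.
  apply Rmult_le_compat_r; [left; apply Rinv_0_lt_compat, Hb2|exact H].
Qed.

(** F'/F is at most 1/sqrt x, so it stays above no positive constant. *)
Lemma bfun_log_derivative_lower mu beta :
  -1 / 2 <= mu -> (forall x, 0 < x -> beta <= bfun' mu x / bfun mu x) -> beta <= 0.
Proof.
  intros Hmu H; apply Rnot_lt_le; intros Hb.
  set (x := / beta ^ 2 + 1).
  assert (Hb2 : 0 < beta ^ 2) by (apply pow_lt, Hb).
  assert (Hx0 : 0 < / beta ^ 2) by (apply Rinv_0_lt_compat, Hb2).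
  assert (Hx : 0 < x) by (unfold x; lra).
  specialize (H x Hx); assert (H2 := bfun_log_derivative_le mu x Hmu Hx).
  assert (H3 : beta ^ 2 <= (bfun' mu x / bfun mu x) ^ 2) by (apply pow_incr; lra).
  assert (H4 : / x < beta ^ 2); [|lra].
  rewrite <- (Rinv_inv (beta ^ 2)); apply Rinv_lt_contravar.
  - apply Rmult_lt_0_compat; assumption.
  - unfold x; lra.
Qed.

(** The Riccati equation x u' = 1 - (mu + 1) u - x u^2 for u = F'/F. *)
Lemma is_derive_log_derivative mu x :
  -1 < mu -> 0 < x ->
  is_derive (fun x => bfun' mu x / bfun mu x) x
    ((1 - (mu + 1) * (bfun' mu x / bfun mu x)) / x - (bfun' mu x / bfun mu x) ^ 2).
Proof.
  intros Hmu Hx; assert (Hb : 0 < bfun mu x) by (apply bfun_pos; lra).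
  assert (H0 := is_derive_bfun mu x Hmu); assert (H1 := is_derive_bfun' mu x Hmu).
  evar_last; [apply (is_derive_div _ _ _ _ _ H1 H0); lra|].
  replace (bfun'' mu x) with ((bfun mu x - (mu + 1) * bfun' mu x) / x)
    by (rewrite <- (bfun_ode mu x Hmu) at 1; field; lra).
  field; lra.
Qed.

(** With a finite list L of zeros, letting M grow in [bfun_zeros_below] gives
    u = F'/F = sum_L 1/(r + x) exactly: a decreasing function, at most m/x for m
    the length of L. In the Riccati equation the terms (mu + 1) u and
    x u^2 are then smaller than 1 for large x, which forces u to increase. *)
Lemma bfun_zeros_unbounded mu M :
  -1 / 2 <= mu -> exists w, M < w /\ bfun mu (- w) = 0.
Proof.
  intros Hmu; assert (Hmu1 : -1 < mu) by lra.
  apply NNPP; intros Hn.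
  set (M0 := Rmax M 0 + 1).
  assert (HM0 : M < M0 /\ 0 < M0)
    by (unfold M0; generalize (Rmax_l M 0), (Rmax_r M 0); lra).
  assert (Hnz : forall w, M < w -> bfun mu (- w) <> 0)
    by (intros w Hw E; apply Hn; exists w; auto).
  destruct (bfun_zeros_below mu M0) as (L & Hnd & HL & Hinv & _); [lra|lra|apply Hnz; lra|].
  assert (Hpos : forall r, In r L -> 0 < r) by (intros r Hr; apply HL in Hr; lra).
  set (A := / (1 + mu)) in *.
  assert (HA : 0 < A) by (apply Rinv_0_lt_compat; lra).
  assert (Hu : forall x, 0 < x ->
    bfun' mu x / bfun mu x = A - sum_over (fun r => / r - / (r + x)) L).
  { intros x Hx; apply Rminus_diag_uniq; apply NNPP; intros Hne.
    set (D := bfun' mu x / bfun mu x - (A - sum_over (fun r => / r - / (r + x)) L)) in Hne.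
    assert (HD : 0 < Rabs D) by apply Rabs_pos_lt, Hne.
    (* beyond this bound the error x A / M1 is smaller than |D| *)
    set (M1 := M0 + 2 * (x * A / Rabs D)).
    assert (HM1 : 0 < x * A / Rabs D)
      by (apply Rdiv_lt_0_compat; [apply Rmult_lt_0_compat|]; lra).
    destruct (bfun_zeros_below mu M1) as (L1 & Hnd1 & HL1 & _ & Hbd);
      [lra|unfold M1; lra|apply Hnz; unfold M1; lra|].
    specialize (Hbd x Hx); fold A in Hbd.
    rewrite (sum_over_same_elements _ L1 L) in Hbd.
    - replace (_ - _ - _) with (- D) in Hbd by (unfold D; ring).
      rewrite Rabs_Ropp in Hbd.
      assert (HxM : x / M1 * A * M1 = x * A) by (field; unfold M1; lra).
      apply (Rmult_le_compat_r M1) in Hbd; [|unfold M1; lra].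
      assert (Hlow : x * A < Rabs D * M1); [|lra].
      apply Rlt_le_trans with (Rabs D * (2 * (x * A / Rabs D))).
      + replace (Rabs D * (2 * (x * A / Rabs D))) with (2 * (x * A)) by (field; lra).
        assert (0 < x * A) by (apply Rmult_lt_0_compat; lra); lra.
      + apply Rmult_le_compat_l; unfold M1; lra.
    - exact Hnd1.
    - exact Hnd.
    - intros w; rewrite HL, HL1; split; intros [Hw Ew]; split; try exact Ew.
      + split; [lra|]; apply Rnot_le_lt; intros Hle; apply (Hnz w); [lra|exact Ew].
      + unfold M1; lra. }
  assert (Hbeta : A - sum_over Rinv L <= 0).
  { apply (bfun_log_derivative_lower mu); [exact Hmu|].
    intros x Hx; rewrite Hu, sum_over_minus by exact Hx.
    change (sum_over (fun r => / r) L) with (sum_over Rinv L).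
    assert (0 <= sum_over (fun r => / (r + x)) L); [|lra].
    apply sum_over_nonneg; intros r Hr; left; apply Rinv_0_lt_compat.
    specialize (Hpos r Hr); lra. }
  assert (Hu' : forall x, 0 < x -> bfun' mu x / bfun mu x = sum_over (fun r => / (r + x)) L).
  { intros x Hx; rewrite Hu, sum_over_minus by exact Hx.
    change (sum_over (fun r => / r) L) with (sum_over Rinv L); lra. }
  set (m := INR (length L)); assert (Hm := pos_INR (length L)); fold m in Hm.
  assert (Hum : forall x, 0 < x -> 0 <= bfun' mu x / bfun mu x <= m * / x).
  { intros x Hx; rewrite Hu' by exact Hx; unfold m; rewrite <- sum_over_const; split.
    - apply sum_over_nonneg; intros r Hr; left; apply Rinv_0_lt_compat.
      specialize (Hpos r Hr); lra.
    - apply sum_over_le; intros r Hr; specialize (Hpos r Hr).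
      apply Rinv_le_contravar; lra. }
  (* beyond X, the bounds u <= m/x make x u' positive *)
  set (X := (mu + 1) * m + m ^ 2 + 1).
  assert (HX : 0 < X) by (unfold X; assert (0 <= m ^ 2) by apply pow2_ge_0; nra).
  destruct (mean_value (fun x => bfun' mu x / bfun mu x)
    (fun x => (1 - (mu + 1) * (bfun' mu x / bfun mu x)) / x - (bfun' mu x / bfun mu x) ^ 2)
    X (X + 1)) as (c & Hc & E); [lra| |].
  - intros x Hx; apply is_derive_log_derivative; lra.
  - assert (Hdec : bfun' mu (X + 1) / bfun mu (X + 1) <= bfun' mu X / bfun mu X).
    { rewrite !Hu' by lra; apply sum_over_le; intros r Hr; specialize (Hpos r Hr).
      apply Rinv_le_contravar; lra. }
    assert (Huc := Hum c ltac:(lra)).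
    set (u := bfun' mu c / bfun mu c) in *.
    assert (Hucm : c * u <= m).
    { replace m with (c * (m * / c)) by (field; lra).
      apply Rmult_le_compat_l; lra. }
    assert (Hpos' : 0 < (1 - (mu + 1) * u) / c - u ^ 2); [|lra].
    replace ((1 - (mu + 1) * u) / c - u ^ 2)
      with ((c - (mu + 1) * (c * u) - (c * u) ^ 2) / c ^ 2) by (field; lra).
    apply Rdiv_lt_0_compat; [|apply pow_lt; lra].
    assert (0 <= c * u) by (apply Rmult_le_pos; lra).
    assert ((c * u) ^ 2 <= m ^ 2) by (apply pow_incr; lra).
    assert ((mu + 1) * (c * u) <= (mu + 1) * m) by (apply Rmult_le_compat_l; lra).
    unfold X in Hc; lra.
Qed.

(** * Numbering the positive zeros *)

Lemma list_min_above (a : R) l :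
  (exists x, In x l /\ a < x) ->
  exists m, In m l /\ a < m /\ forall x, In x l -> a < x -> m <= x.
Proof.
  induction l as [|y l IH]; intros (x & Hx & Hax); [destruct Hx|].
  destruct (classic (exists x, In x l /\ a < x)) as [Hex|Hno].
  - destruct (IH Hex) as (m & Hm & Ham & Hmin).
    destruct (Rlt_dec a y) as [Hay|Hay]; [destruct (Rle_dec y m) as [Hym|Hym]|].
    + exists y; split; [left; reflexivity|split; [exact Hay|]].
      intros z [<-|Hz] Haz; [lra|specialize (Hmin z Hz Haz); lra].
    + exists m; split; [right; exact Hm|split; [exact Ham|]].
      intros z [<-|Hz] Haz; [lra|apply Hmin; assumption].
    + exists m; split; [right; exact Hm|split; [exact Ham|]].
      intros z [<-|Hz] Haz; [lra|apply Hmin; assumption].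
  - assert (x = y) as -> by (destruct Hx as [E|Hx]; [congruence|destruct Hno; exists x; auto]).
    exists y; split; [left; reflexivity|split; [exact Hax|]].
    intros z [<-|Hz] Haz; [lra|destruct Hno; exists z; auto].
Qed.

(** The bound M' is left to choose, so that it can avoid the zeros of f. *)
Definition locally_finite_zeros (f : R -> R) : Prop :=
  forall M, exists M' l, M < M' /\ forall w, In w l <-> (0 < w < M' /\ f w = 0).

Lemma next_zero f a :
  locally_finite_zeros f -> (forall M, exists w, M < w /\ f w = 0) -> 0 <= a ->
  exists z, a < z /\ f z = 0 /\ forall w, a < w < z -> f w <> 0.
Proof.
  intros Hfin Hunb Ha; destruct (Hunb a) as (w & Hw & Ew).
  destruct (Hfin w) as (M & l & HwM & Hl).
  destruct (list_min_above a l) as (z & Hz & Haz & Hmin).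
  { exists w; split; [apply Hl; split; [lra|exact Ew]|exact Hw]. }
  apply Hl in Hz; exists z; split; [exact Haz|split; [apply Hz|]].
  intros v Hv Ev; assert (z <= v); [|lra].
  apply Hmin; [apply Hl; split; [lra|exact Ev]|lra].
Qed.

Lemma nth_positive_zero_exists f n :
  locally_finite_zeros f -> (forall M, exists w, M < w /\ f w = 0) ->
  exists z, is_nth_positive_zero f (S n) z.
Proof.
  intros Hfin Hunb; induction n as [|n (z & Hz & Ez & l & Hnd & Hlen & Hl)].
  - destruct (next_zero f 0 Hfin Hunb) as (z & Hz & Ez & Hno); [lra|].
    exists z; split; [exact Hz|split; [exact Ez|]].
    exists nil; split; [constructor|split; [reflexivity|]].
    intros w; split; [intros []|intros [Hw Ew]; destruct (Hno w Hw Ew)].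
  - destruct (next_zero f z Hfin Hunb) as (z' & Hz' & Ez' & Hno); [lra|].
    exists z'; split; [lra|split; [exact Ez'|]].
    exists (z :: l); split; [|split].
    + constructor; [intros Hin; apply Hl in Hin; lra|exact Hnd].
    + simpl; rewrite Hlen; reflexivity.
    + intros w; split.
      * intros [<-|Hw]; [split; [lra|exact Ez]|apply Hl in Hw; split; [lra|apply Hw]].
      * intros [Hw Ew]; destruct (Rtotal_order w z) as [H|[H|H]].
        -- right; apply Hl; split; [lra|exact Ew].
        -- left; congruence.
        -- destruct (Hno w ltac:(lra) Ew).
Qed.

(** The list of the zeros before z contains y and all the zeros before y. *)
Lemma nth_positive_zero_lt f m n y z :
  is_nth_positive_zero f m y -> is_nth_positive_zero f n z -> y < z -> (m < n)%nat.
Proof.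
  intros (Hy & Ey & l & Hnd & Hlen & Hl) (Hz & Ez & l' & Hnd' & Hlen' & Hl') Hyz.
  assert (H : (length (y :: l) <= length l')%nat); [|simpl in H; lia].
  apply NoDup_incl_length.
  - constructor; [intros Hin; apply Hl in Hin; lra|exact Hnd].
  - intros w [<-|Hw]; apply Hl'; [split; [lra|exact Ey]|].
    apply Hl in Hw; split; [lra|apply Hw].
Qed.

Lemma nth_positive_zero_rank f m n z :
  is_nth_positive_zero f m z -> is_nth_positive_zero f n z -> m = n.
Proof.
  intros (_ & _ & l & Hnd & Hlen & Hl) (_ & _ & l' & Hnd' & Hlen' & Hl').
  rewrite <- Hlen, <- Hlen'; f_equal; apply Permutation_length, NoDup_Permutation;
    [assumption|assumption|intros w; rewrite Hl, Hl'; reflexivity].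
Qed.

Lemma nth_positive_zero_incr f m n y z :
  is_nth_positive_zero f m y -> is_nth_positive_zero f n z -> (m < n)%nat -> y < z.
Proof.
  intros Hy Hz Hmn; destruct (Rtotal_order y z) as [H|[<-|H]]; [exact H| |].
  - assert (H := nth_positive_zero_rank f m n y Hy Hz); lia.
  - assert (H' := nth_positive_zero_lt f n m z y Hz Hy H); lia.
Qed.

Lemma positive_zeros_below_nth f (z : nat -> R) N :
  (forall n, is_nth_positive_zero f (S n) (z n)) ->
  NoDup (map z (seq 0 N)) /\
  forall w, In w (map z (seq 0 N)) <-> (0 < w < z N /\ f w = 0).
Proof.
  intros Hz.
  assert (Hincr : forall m n, (m < n)%nat -> z m < z n).
  { intros m n Hmn; apply (nth_positive_zero_incr f (S m) (S n)); [apply Hz|apply Hz|lia]. }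
  assert (Hnd : NoDup (map z (seq 0 N))).
  { apply NoDup_map_NoDup_ForallPairs; [|apply seq_NoDup].
    intros m n _ _ E; destruct (Nat.lt_trichotomy m n) as [H|[H|H]]; [|exact H|];
      specialize (Hincr _ _ H); lra. }
  assert (Hincl : forall w, In w (map z (seq 0 N)) -> 0 < w < z N /\ f w = 0).
  { intros w Hw; apply in_map_iff in Hw; destruct Hw as (n & <- & Hn); apply in_seq in Hn.
    destruct (Hz n) as (H0 & H1 & _); split; [split; [exact H0|apply Hincr; lia]|exact H1]. }
  split; [exact Hnd|intros w; split; [apply Hincl|intros Hw]].
  destruct (Hz N) as (_ & _ & l & Hndl & Hlen & Hl).
  apply (NoDup_length_incl Hnd (l' := l)); [|intros v Hv; apply Hl, Hincl, Hv|apply Hl, Hw].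
  rewrite length_map, length_seq; lia.
Qed.

Lemma bfun_nonzero_between mu a b :
  -1 < mu -> 0 <= a < b -> exists t, a < t < b /\ bfun mu (- t) <> 0.
Proof.
  intros Hmu Hab; apply NNPP; intros Hn.
  assert (H0 : forall t, a < t < b -> bfun mu (- t) = 0)
    by (intros t Ht; apply NNPP; intros E; apply Hn; exists t; auto).
  destruct (mean_value (fun t => bfun mu (- t)) (fun t => - bfun' mu (- t))
              ((2 * a + b) / 3) ((a + 2 * b) / 3)) as (c & Hc & E); [lra| |].
  - intros x _; apply is_derive_reflect, is_derive_bfun, Hmu.
  - rewrite !H0 in E by lra.
    apply (bfun_simple_zeros mu (- c) Hmu); [lra|apply H0; lra|].
    assert (- bfun' mu (- c) = 0); [|lra].
    apply (Rmult_eq_reg_r ((a + 2 * b) / 3 - (2 * a + b) / 3)); lra.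
Qed.

(** Zeros w of J correspond to zeros w^2/4 of F(-t). *)
Lemma bessel_J_zeros_locally_finite mu :
  -1 < mu -> locally_finite_zeros (bessel_J mu).
Proof.
  intros Hmu M; set (m := Rmax M 0 + 1).
  assert (Hm : M < m /\ 0 < m) by (unfold m; generalize (Rmax_l M 0), (Rmax_r M 0); lra).
  assert (Hm2 : 0 < m ^ 2 / 4) by (assert (0 < m ^ 2) by (apply pow_lt; lra); lra).
  destruct (bfun_nonzero_between mu (m ^ 2 / 4) (m ^ 2 / 4 + 1) Hmu) as (t & Ht & Et); [lra|].
  destruct (bfun_zeros_below mu t Hmu) as (L & _ & HL & _); [lra|exact Et|].
  exists (2 * sqrt t), (map (fun w => 2 * sqrt w) L); split.
  - assert (m / 2 < sqrt t); [|lra].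
    rewrite <- (sqrt_pow2 (m / 2)) by lra; apply sqrt_lt_1; nra.
  - intros w; rewrite in_map_iff; split.
    + intros (v & <- & Hv); apply HL in Hv.
      assert (0 < sqrt v) by (apply sqrt_lt_R0; lra).
      assert (sqrt v < sqrt t) by (apply sqrt_lt_1; lra).
      split; [lra|]; apply bessel_J_eq_0; [exact Hmu|lra|].
      replace ((2 * sqrt v) ^ 2 / 4) with v; [apply Hv|].
      replace ((2 * sqrt v) ^ 2 / 4) with (sqrt v * sqrt v) by field.
      rewrite sqrt_sqrt; lra.
    + intros [Hw Ew]; exists (w ^ 2 / 4); split.
      * replace (w ^ 2 / 4) with ((w / 2) ^ 2) by field; rewrite sqrt_pow2; lra.
      * apply HL; split; [split|].
        -- assert (0 < w ^ 2) by (apply pow_lt; lra); lra.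
        -- assert (Hs : sqrt t * sqrt t = t) by (apply sqrt_sqrt; lra).
           rewrite <- Hs; nra.
        -- apply bessel_J_eq_0; [exact Hmu|lra|exact Ew].
Qed.

Lemma bessel_J_zeros_unbounded mu M :
  -1 / 2 <= mu -> exists w, M < w /\ bessel_J mu w = 0.
Proof.
  intros Hmu; destruct (bfun_zeros_unbounded mu (M ^ 2 / 4) Hmu) as (v & Hv & Ev).
  assert (H0 : 0 <= M ^ 2) by apply pow2_ge_0.
  assert (Hs : 0 < sqrt v) by (apply sqrt_lt_R0; lra).
  assert (Hv2 : sqrt v * sqrt v = v) by (apply sqrt_sqrt; lra).
  exists (2 * sqrt v); split.
  - apply Rnot_le_lt; intros Hle; nra.
  - apply bessel_J_eq_0; [lra|lra|].
    replace ((2 * sqrt v) ^ 2 / 4) with (sqrt v * sqrt v) by field.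
    rewrite Hv2; exact Ev.
Qed.

Lemma bessel_J_zero_spec mu n :
  -1 / 2 <= mu -> is_nth_positive_zero (bessel_J mu) (S n) (bessel_J_zero mu (S n)).
Proof.
  intros Hmu; unfold bessel_J_zero; apply epsilon_spec, nth_positive_zero_exists.
  - apply bessel_J_zeros_locally_finite; lra.
  - intros M; apply bessel_J_zeros_unbounded, Hmu.
Qed.

(** * The partial fraction expansion of the logarithmic derivative *)

Definition bfun_zero (mu : R) (n : nat) : R := bessel_J_zero mu (S n) ^ 2 / 4.

Lemma bfun_zero_gt_0 mu n : -1 / 2 <= mu -> 0 < bfun_zero mu n.
Proof.
  intros Hmu; destruct (bessel_J_zero_spec mu n Hmu) as [H _].
  unfold bfun_zero; apply Rdiv_lt_0_compat; [apply pow_lt, H|lra].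
Qed.

Lemma bfun_zero_spec mu n :
  -1 / 2 <= mu -> is_nth_positive_zero (fun t => bfun mu (- t)) (S n) (bfun_zero mu n).
Proof.
  intros Hmu; assert (H0 := bfun_zero_gt_0 mu n Hmu).
  destruct (bessel_J_zero_spec mu n Hmu) as (Hj & Ej & l & Hnd & Hlen & Hl).
  set (j := bessel_J_zero mu (S n)) in *.
  split; [exact H0|split; [apply bessel_J_eq_0; [lra|exact Hj|exact Ej]|]].
  exists (map (fun w => w ^ 2 / 4) l); split; [|split].
  - apply NoDup_map_NoDup_ForallPairs; [|exact Hnd].
    intros v w Hv Hw E; apply Hl in Hv; apply Hl in Hw; nra.
  - rewrite length_map; exact Hlen.
  - intros t; rewrite in_map_iff; unfold bfun_zero; fold j; split.
    + intros (w & <- & Hw); apply Hl in Hw; split; [nra|].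
      apply bessel_J_eq_0; [lra|lra|apply Hw].
    + intros [Ht Et]; assert (Hs : 0 < sqrt t) by (apply sqrt_lt_R0; lra).
      assert (Hs2 : sqrt t * sqrt t = t) by (apply sqrt_sqrt; lra).
      assert (E : (2 * sqrt t) ^ 2 / 4 = t)
        by (replace ((2 * sqrt t) ^ 2 / 4) with (sqrt t * sqrt t) by field; exact Hs2).
      exists (2 * sqrt t); split; [exact E|].
      apply Hl; split; [split; [lra|apply Rnot_le_lt; intros Hle; nra]|].
      apply bessel_J_eq_0; [lra|lra|rewrite E; exact Et].
Qed.

Lemma sum_over_map_seq f (z : nat -> R) N :
  sum_over f (map z (seq 0 (S N))) = sum_n (fun n => f (z n)) N.
Proof.
  induction N as [|N IH].
  - rewrite sum_O; unfold sum_over; simpl; ring.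
  - rewrite seq_S, map_app, sum_over_app, IH, sum_Sn; simpl.
    unfold plus; simpl; unfold sum_over; simpl; ring.
Qed.

(** [bfun_zeros_below] with a bound chosen between two consecutive zeros, which
    turns the unordered finite sums into partial sums of series. *)
Lemma bfun_zero_partial_sums mu N :
  -1 / 2 <= mu ->
  sum_n (fun n => / bfun_zero mu n) N <= / (1 + mu) /\
  forall x, 0 < x ->
    Rabs (/ (1 + mu) - bfun' mu x / bfun mu x
          - sum_n (fun n => / bfun_zero mu n - / (bfun_zero mu n + x)) N)
    <= x * / (1 + mu) * / bfun_zero mu N.
Proof.
  intros Hmu; set (z := bfun_zero mu); set (f := fun t => bfun mu (- t)).
  assert (Hz : forall n, is_nth_positive_zero f (S n) (z n))
    by (intros n; apply bfun_zero_spec, Hmu).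
  assert (Hincr : z N < z (S N)).
  { apply (nth_positive_zero_incr f (S N) (S (S N))); [apply Hz|apply Hz|lia]. }
  assert (HzN : 0 < z N) by apply bfun_zero_gt_0, Hmu.
  destruct (positive_zeros_below_nth f z (S N) Hz) as [Hnd Hin].
  destruct (bfun_nonzero_between mu (z N) (z (S N))) as (M & HM & EM); [lra|lra|].
  destruct (bfun_zeros_below mu M) as (L & HndL & HL & Hinv & Hbd); [lra|lra|exact EM|].
  assert (Hsame : forall h, sum_over h L = sum_n (fun n => h (z n)) N).
  { intros h; rewrite <- sum_over_map_seq; apply sum_over_same_elements;
      [exact HndL|exact Hnd|].
    intros w; rewrite HL, Hin; split; intros [Hw Ew]; (split; [|exact Ew]); [lra|].
    split; [lra|].
    destruct (proj1 (in_map_iff _ _ _) (proj2 (Hin w) (conj Hw Ew))) as (n & <- & Hn).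
    apply in_seq in Hn; destruct (Nat.eq_dec n N) as [->|HnN]; [lra|].
    apply Rlt_trans with (z N); [|lra].
    apply (nth_positive_zero_incr f (S n) (S N)); [apply Hz|apply Hz|lia]. }
  split; [rewrite <- (Hsame Rinv); exact Hinv|].
  intros x Hx; rewrite <- (Hsame (fun r => / r - / (r + x))).
  apply Rle_trans with (1 := Hbd x Hx).
  unfold Rdiv; rewrite Rmult_assoc, (Rmult_comm (/ M)), <- Rmult_assoc.
  apply Rmult_le_compat_l; [|apply Rinv_le_contravar; lra].
  apply Rmult_le_pos; [lra|left; apply Rinv_0_lt_compat; lra].
Qed.

Lemma ex_series_inv_bfun_zero mu :
  -1 / 2 <= mu -> ex_series (fun n => / bfun_zero mu n).
Proof.
  intros Hmu.
  destruct (ex_finite_lim_seq_incr (sum_n (fun n => / bfun_zero mu n)) (/ (1 + mu))) as [l Hl].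
  - intros n; rewrite sum_Sn; unfold plus; simpl.
    assert (0 < / bfun_zero mu (S n)) by (apply Rinv_0_lt_compat, bfun_zero_gt_0, Hmu); lra.
  - intros n; apply bfun_zero_partial_sums, Hmu.
  - exists l; exact Hl.
Qed.

(** The convergent sum S of the 1/z_n is at most A = 1/(1 + mu), and the limit
    formula reads F'/F = (A - S) + sum_n 1/(z_n + x). The constant A - S is a
    lower bound of F'/F, hence is 0. *)
Lemma bfun_log_derivative_series mu x :
  -1 / 2 <= mu -> 0 < x ->
  is_series (fun n => / (bfun_zero mu n + x)) (bfun' mu x / bfun mu x).
Proof.
  intros Hmu Hx; set (z := bfun_zero mu); set (A := / (1 + mu)).
  assert (Hz : forall n, 0 < z n) by (intros n; apply bfun_zero_gt_0, Hmu).
  assert (Hex := ex_series_inv_bfun_zero mu Hmu); fold z in Hex.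
  set (Sz := Series (fun n => / z n)).
  assert (Hsz : is_series (fun n => / z n) Sz) by apply Series_correct, Hex.
  assert (HSA : Sz <= A).
  { apply (is_lim_seq_le (sum_n (fun n => / z n)) (fun _ => A) Sz A).
    - intros n; apply bfun_zero_partial_sums, Hmu.
    - exact Hsz.
    - apply is_lim_seq_const. }
  assert (Hdiff : forall y, 0 < y ->
            is_series (fun n => / z n - / (z n + y)) (A - bfun' mu y / bfun mu y)).
  { intros y Hy; set (l := A - bfun' mu y / bfun mu y).
    assert (Hbd : is_lim_seq (fun N => l - sum_n (fun n => / z n - / (z n + y)) N) 0).
    { apply is_lim_seq_abs_0.
      apply (is_lim_seq_le_le (fun _ => 0) _ (fun N => y * A * / z N)).
      - intros N; split; [apply Rabs_pos|apply bfun_zero_partial_sums; assumption].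
      - apply is_lim_seq_const.
      - replace 0 with (y * A * 0) by ring.
        apply (is_lim_seq_scal_l _ (y * A) 0), ex_series_lim_0, Hex. }
    assert (Hl := is_lim_seq_minus' _ _ l 0 (is_lim_seq_const l) Hbd).
    rewrite Rminus_0_r in Hl.
    refine (is_lim_seq_ext _ (sum_n (fun n => / z n - / (z n + y))) l _ Hl).
    intros N; ring. }
  assert (Hsum : forall y, 0 < y ->
            is_series (fun n => / (z n + y)) (Sz - A + bfun' mu y / bfun mu y)).
  { intros y Hy.
    apply (is_series_ext (fun n => / z n - (/ z n - / (z n + y)))).
    { intros n; change (/ z n - (/ z n - / (z n + y)) = / (z n + y)); ring. }
    replace (Sz - A + bfun' mu y / bfun mu y) with (Sz - (A - bfun' mu y / bfun mu y)) by ring.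
    apply (is_series_minus (V := R_NormedModule)); [exact Hsz|apply Hdiff, Hy]. }
  assert (HA : A - Sz <= 0).
  { apply (bfun_log_derivative_lower mu); [exact Hmu|intros y Hy].
    assert (0 <= Sz - A + bfun' mu y / bfun mu y); [|lra].
    apply (is_lim_seq_le (fun _ => 0) (sum_n (fun n => / (z n + y))) 0
             (Sz - A + bfun' mu y / bfun mu y)).
    - intros N; induction N as [|N IH].
      + rewrite sum_O; left; apply Rinv_0_lt_compat; specialize (Hz 0%nat); lra.
      + rewrite sum_Sn; apply Rplus_le_le_0_compat; [exact IH|].
        left; apply Rinv_0_lt_compat; specialize (Hz (S N)); lra.
    - apply is_lim_seq_const.
    - apply Hsum, Hy. }
  replace (bfun' mu x / bfun mu x) with (Sz - A + bfun' mu x / bfun mu x) by lra.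
  apply Hsum, Hx.
Qed.

(** * Termwise differentiation *)

Lemma mean_value_between (f f' : R -> R) (a r x : R) :
  (forall y, Rabs (y - a) < r -> is_derive f y (f' y)) -> Rabs (x - a) < r ->
  exists c, Rabs (c - a) <= Rabs (x - a) /\ f x - f a = f' c * (x - a).
Proof.
  intros Hf Hx.
  destruct (MVT_gen f a x f') as (c & Hc & E).
  - intros y Hy; apply Hf; revert Hx; unfold Rmin, Rmax in Hy.
    destruct (Rle_dec a x); unfold Rabs; destruct (Rcase_abs (x - a)), (Rcase_abs (y - a)); lra.
  - intros y Hy; apply (is_derive_continuity_pt _ _ (f' y)), Hf.
    revert Hx; unfold Rmin, Rmax in Hy.
    destruct (Rle_dec a x); unfold Rabs; destruct (Rcase_abs (x - a)), (Rcase_abs (y - a)); lra.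
  - exists c; split; [|exact E].
    unfold Rmin, Rmax in Hc.
    destruct (Rle_dec a x); unfold Rabs; destruct (Rcase_abs (x - a)), (Rcase_abs (c - a)); lra.
Qed.

(** By the mean value theorem applied twice, each difference quotient differs
    from the derivative at s by at most C n |h|, and these bounds are
    summable. *)
Lemma is_derive_Series (u u' u'' : nat -> R -> R) (C : nat -> R) (s r : R) :
  0 < r ->
  (forall n y, Rabs (y - s) < r -> is_derive (u n) y (u' n y)) ->
  (forall n y, Rabs (y - s) < r -> is_derive (u' n) y (u'' n y)) ->
  (forall n y, Rabs (y - s) < r -> Rabs (u'' n y) <= C n) ->
  ex_series C ->
  (forall y, Rabs (y - s) < r -> ex_series (fun n => u n y)) ->
  ex_series (fun n => u' n s) ->
  is_derive (fun y => Series (fun n => u n y)) s (Series (fun n => u' n s)).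
Proof.
  intros Hr Hu Hu' Hbd HC Hex Hex'.
  assert (Hs : Rabs (s - s) < r) by (rewrite Rminus_diag, Rabs_R0; exact Hr).
  assert (HC0 : forall n, 0 <= C n)
    by (intros n; apply Rle_trans with (2 := Hbd n s Hs), Rabs_pos).
  assert (Hterm : forall n h, h <> 0 -> Rabs h < r ->
            Rabs ((u n (s + h) - u n s) * / h - u' n s) <= C n * Rabs h).
  { intros n h Hh0 Hh.
    assert (Hsh : s + h - s = h) by ring.
    destruct (mean_value_between (u n) (u' n) s r (s + h) (Hu n)) as (c & Hc & E);
      [rewrite Hsh; exact Hh|].
    rewrite Hsh in Hc, E.
    destruct (mean_value_between (u' n) (u'' n) s r c (Hu' n)) as (d & Hd & E'); [lra|].
    rewrite E; replace (u' n c * h * / h - u' n s) with (u' n c - u' n s) by (field; exact Hh0).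
    rewrite E', Rabs_mult; apply Rmult_le_compat; try apply Rabs_pos; [|exact Hc].
    apply Hbd; lra. }
  assert (HS0 : 0 <= Series C)
    by (apply Series_nonneg; assumption).
  apply is_derive_Reals; intros eps Heps.
  assert (Hd : 0 < Rmin r (eps / (Series C + 1))).
  { apply Rmin_glb_lt; [exact Hr|apply Rdiv_lt_0_compat; lra]. }
  exists (mkposreal _ Hd); intros h Hh0 Hh; simpl in Hh.
  assert (Hhr : Rabs h < r) by (apply Rlt_le_trans with (1 := Hh), Rmin_l).
  assert (Hhe : Rabs h < eps / (Series C + 1)) by (apply Rlt_le_trans with (1 := Hh), Rmin_r).
  assert (Hexh : ex_series (fun n => u n (s + h)))
    by (apply Hex; replace (s + h - s) with h by ring; exact Hhr).
  assert (Hexd : ex_series (fun n => (u n (s + h) - u n s) * / h)).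
  { apply ex_series_scal_r, (ex_series_minus (V := R_NormedModule)); [exact Hexh|apply Hex, Hs]. }
  unfold Rdiv; rewrite <- Series_minus by (auto using Hex).
  rewrite <- Series_scal_r, <- Series_minus by assumption.
  assert (HCh : ex_series (fun n => C n * Rabs h)) by apply ex_series_scal_r, HC.
  assert (Hle : forall n, 0 <= Rabs ((u n (s + h) - u n s) * / h - u' n s) <= C n * Rabs h)
    by (intros n; split; [apply Rabs_pos|apply Hterm; assumption]).
  apply Rle_lt_trans with (1 := Series_Rabs _ (ex_series_le (V := R_CompleteNormedModule) _ _
      (fun n => Rle_trans _ _ _ (Req_le _ _ (Rabs_Rabsolu _)) (proj2 (Hle n))) HCh)).
  apply Rle_lt_trans with (1 := Series_le _ _ Hle HCh).
  rewrite Series_scal_r.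
  apply Rle_lt_trans with ((Series C + 1) * Rabs h).
  - apply Rmult_le_compat_r; [apply Rabs_pos|lra].
  - apply (Rmult_lt_compat_l (Series C + 1)) in Hhe; [|lra].
    replace ((Series C + 1) * (eps / (Series C + 1))) with eps in Hhe by (field; lra).
    exact Hhe.
Qed.

(** * Partial fractions and Bernstein functions *)

Definition summable_inv (b : nat -> R) : Prop :=
  (forall n, 0 < b n) /\ ex_series (fun n => / b n).

(** For p >= 2 these series are, up to constant factors, the derivatives
    of the sum of the s/(s + b n) = 1 - b n/(s + b n). *)
Definition stieltjes (b : nat -> R) (p : nat) (s : R) : R :=
  Series (fun n => b n / (s + b n) ^ p).

(** Two factors y + b are used against b to leave the summable 1/b. *)
Lemma stieltjes_term_le b p s y :
  0 < b -> 0 < s <= y -> 0 <= b / (y + b) ^ (p + 2) <= / b * / s ^ p.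
Proof.
  intros Hb Hs.
  assert (H1 : 0 < (y + b) ^ p) by (apply pow_lt; lra).
  assert (H2 : 0 < (y + b) ^ 2) by (apply pow_lt; lra).
  rewrite pow_add.
  replace (b / ((y + b) ^ p * (y + b) ^ 2)) with (b / (y + b) ^ 2 * / (y + b) ^ p)
    by (field; lra).
  assert (H3 : 0 < b / (y + b) ^ 2) by (apply Rdiv_lt_0_compat; lra).
  assert (H4 : 0 < / (y + b) ^ p) by (apply Rinv_0_lt_compat, H1).
  split; [apply Rmult_le_pos; lra|].
  apply Rmult_le_compat; try lra.
  - apply (Rmult_le_reg_r (b * (y + b) ^ 2)); [apply Rmult_lt_0_compat; lra|].
    replace (b / (y + b) ^ 2 * (b * (y + b) ^ 2)) with (b ^ 2) by (field; lra).
    replace (/ b * (b * (y + b) ^ 2)) with ((y + b) ^ 2) by (field; lra).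
    apply pow_incr; lra.
  - apply Rinv_le_contravar; [apply pow_lt; lra|apply pow_incr; lra].
Qed.

Lemma ex_series_stieltjes b p s :
  summable_inv b -> 0 < s -> ex_series (fun n => b n / (s + b n) ^ (p + 2)).
Proof.
  intros [Hb Hex] Hs.
  apply (ex_series_le (V := R_CompleteNormedModule) _ (fun n => / b n * / s ^ p)).
  - intros n; destruct (stieltjes_term_le (b n) p s s (Hb n)) as [H1 H2]; [lra|].
    change (Rabs (b n / (s + b n) ^ (p + 2)) <= / b n * / s ^ p).
    rewrite Rabs_pos_eq; assumption.
  - apply ex_series_scal_r, Hex.
Qed.

Lemma stieltjes_nonneg b p s :
  summable_inv b -> 0 < s -> 0 <= stieltjes b (p + 2) s.
Proof.
  intros Hb Hs; apply Series_nonneg; [|apply ex_series_stieltjes; assumption].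
  intros n; apply (stieltjes_term_le (b n) p s s (proj1 Hb n)); lra.
Qed.

Lemma near_half s y : 0 < s -> Rabs (y - s) < s / 2 -> 0 < s / 2 <= y.
Proof. intros Hs H; apply Rabs_def2 in H; lra. Qed.

Lemma is_derive_stieltjes_term b p y :
  0 < b -> 0 < y ->
  is_derive (fun y => b / (y + b) ^ p) y (- INR p * (b / (y + b) ^ (p + 1))).
Proof.
  intros Hb Hy; assert (H : 0 < (y + b) ^ p) by (apply pow_lt; lra).
  auto_derive; [lra|].
  destruct p as [|p]; [simpl; field; lra|].
  rewrite Nat.add_1_r; rewrite <- !tech_pow_Rmult in *; simpl pred.
  assert (0 < (y + b) ^ p) by (apply pow_lt; lra); field; lra.
Qed.

Lemma is_derive_stieltjes b p s :
  summable_inv b -> 0 < s ->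
  is_derive (stieltjes b (p + 2)) s (- INR (p + 2) * stieltjes b (p + 3) s).
Proof.
  intros Hb Hs; assert (Hb0 := proj1 Hb).
  unfold stieltjes; rewrite <- Series_scal_l.
  apply (is_derive_Series (fun n y => b n / (y + b n) ^ (p + 2))
    (fun n y => - INR (p + 2) * (b n / (y + b n) ^ (p + 3)))
    (fun n y => - INR (p + 2) * (- INR (p + 3) * (b n / (y + b n) ^ (p + 4))))
    (fun n => INR (p + 2) * (INR (p + 3) * (/ b n * / (s / 2) ^ (p + 2)))) s (s / 2)).
  - lra.
  - intros n y Hy; apply near_half in Hy; [|exact Hs].
    replace (p + 3)%nat with (p + 2 + 1)%nat by lia.
    apply is_derive_stieltjes_term; [apply Hb0|lra].
  - intros n y Hy; apply near_half in Hy; [|exact Hs].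
    apply (is_derive_scal (fun y => b n / (y + b n) ^ (p + 3)) y (- INR (p + 2))).
    replace (p + 4)%nat with (p + 3 + 1)%nat by lia.
    apply is_derive_stieltjes_term; [apply Hb0|lra].
  - intros n y Hy; apply near_half in Hy; [|exact Hs].
    destruct (stieltjes_term_le (b n) (p + 2) (s / 2) y (Hb0 n) Hy) as [H1 H2].
    replace (p + 2 + 2)%nat with (p + 4)%nat in * by lia.
    rewrite !Rabs_mult, !Rabs_Ropp, !(Rabs_pos_eq (INR _)) by apply pos_INR.
    rewrite Rabs_pos_eq by exact H1.
    apply Rmult_le_compat_l; [apply pos_INR|].
    apply Rmult_le_compat_l; [apply pos_INR|exact H2].
  - apply (ex_series_scal_l (INR (p + 2)) (fun n => INR (p + 3) * (/ b n * / (s / 2) ^ (p + 2)))).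
    apply (ex_series_scal_l (INR (p + 3)) (fun n => / b n * / (s / 2) ^ (p + 2))).
    apply ex_series_scal_r, (proj2 Hb).
  - intros y Hy; apply near_half in Hy; [|exact Hs].
    apply ex_series_stieltjes; [exact Hb|lra].
  - apply (ex_series_scal_l (- INR (p + 2)) (fun n => b n / (s + b n) ^ (p + 3))).
    replace (p + 3)%nat with (p + 1 + 2)%nat by lia.
    apply ex_series_stieltjes; assumption.
Qed.

Lemma ex_series_partial_fractions b s :
  summable_inv b -> 0 < s -> ex_series (fun n => s / (s + b n)).
Proof.
  intros [Hb Hex] Hs.
  apply (ex_series_le (V := R_CompleteNormedModule) _ (fun n => s * / b n)).
  - intros n; specialize (Hb n).
    change (Rabs (s / (s + b n)) <= s * / b n).
    rewrite Rabs_pos_eq by (apply Rdiv_le_0_compat; lra).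
    apply Rmult_le_compat_l; [lra|apply Rinv_le_contravar; lra].
  - apply (ex_series_scal_l s (fun n => / b n)), Hex.
Qed.

Lemma is_derive_partial_fractions b s :
  summable_inv b -> 0 < s ->
  is_derive (fun y => Series (fun n => y / (y + b n))) s (stieltjes b 2 s).
Proof.
  intros Hb Hs; assert (Hb0 := proj1 Hb).
  apply (is_derive_Series (fun n y => y / (y + b n)) (fun n y => b n / (y + b n) ^ 2)
    (fun n y => - INR 2 * (b n / (y + b n) ^ 3))
    (fun n => INR 2 * (/ b n * / (s / 2) ^ 1)) s (s / 2)).
  - lra.
  - intros n y Hy; apply near_half in Hy; [|exact Hs]; specialize (Hb0 n).
    auto_derive; [lra|field; lra].
  - intros n y Hy; apply near_half in Hy; [|exact Hs].
    apply (is_derive_stieltjes_term (b n) 2); [apply Hb0|lra].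
  - intros n y Hy; apply near_half in Hy; [|exact Hs].
    destruct (stieltjes_term_le (b n) 1 (s / 2) y (Hb0 n) Hy) as [H1 H2].
    rewrite Rabs_mult, Rabs_Ropp, (Rabs_pos_eq (INR 2)) by apply pos_INR.
    rewrite Rabs_pos_eq by exact H1.
    apply Rmult_le_compat_l; [apply pos_INR|exact H2].
  - apply (ex_series_scal_l (INR 2) (fun n => / b n * / (s / 2) ^ 1)).
    apply ex_series_scal_r, (proj2 Hb).
  - intros y Hy; apply near_half in Hy; [|exact Hs].
    apply ex_series_partial_fractions; [exact Hb|lra].
  - apply (ex_series_stieltjes b 0); assumption.
Qed.

Lemma locally_pos (P : R -> Prop) s : 0 < s -> (forall y, 0 < y -> P y) -> locally s P.
Proof.
  intros Hs HP; exists (mkposreal s Hs); intros y Hy; apply HP.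
  change (Rabs (y - s) < s) in Hy; apply Rabs_def2 in Hy; lra.
Qed.

Lemma Derive_n_partial_fractions b (g : R -> R) c :
  summable_inv b ->
  (forall s, 0 < s -> g s = c + 2 * Series (fun n => s / (s + b n))) ->
  forall n s, 0 < s ->
  is_derive (Derive_n g n) s (2 * ((-1) ^ n * INR (fact (S n)) * stieltjes b (n + 2) s)).
Proof.
  intros Hb Hg n; induction n as [|n IH]; intros s Hs.
  - simpl Derive_n.
    apply (is_derive_ext_loc (fun s => c + 2 * Series (fun n => s / (s + b n)))).
    + apply locally_pos; [exact Hs|intros y Hy; symmetry; apply Hg, Hy].
    + evar_last.
      * apply (is_derive_plus (V := R_NormedModule) (fun _ => c)
                 (fun s => 2 * Series (fun n => s / (s + b n)))).
        -- apply (is_derive_const (V := R_NormedModule)).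
        -- apply (is_derive_scal (fun s => Series (fun n => s / (s + b n))) s 2).
           apply is_derive_partial_fractions; assumption.
      * change (0 + 2 * stieltjes b 2 s = 2 * (1 * INR (fact 1) * stieltjes b 2 s)).
        simpl; ring.
  - apply (is_derive_ext_loc
      (fun y => 2 * ((-1) ^ n * INR (fact (S n)) * stieltjes b (n + 2) y))).
    + apply locally_pos; [exact Hs|].
      intros y Hy; symmetry; apply is_derive_unique, IH, Hy.
    + replace (2 * ((-1) ^ S n * INR (fact (S (S n))) * stieltjes b (S n + 2) s))
        with (2 * ((-1) ^ n * INR (fact (S n)) * (- INR (n + 2) * stieltjes b (n + 3) s))).
      * apply (is_derive_scal (fun y => (-1) ^ n * INR (fact (S n)) * stieltjes b (n + 2) y) s 2).
        apply (is_derive_scal (stieltjes b (n + 2)) s ((-1) ^ n * INR (fact (S n)))).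
        apply is_derive_stieltjes; assumption.
      * rewrite (fact_simpl (S n)), mult_INR.
        replace (S n + 2)%nat with (n + 3)%nat by lia.
        replace (n + 2)%nat with (S (S n)) by lia; simpl ((-1) ^ S n); ring.
Qed.

Lemma Bernstein_partial_fractions b (g : R -> R) c :
  summable_inv b -> 0 <= c ->
  (forall s, 0 < s -> g s = c + 2 * Series (fun n => s / (s + b n))) ->
  Bernstein g.
Proof.
  intros Hb Hc Hg; assert (Hd := Derive_n_partial_fractions b g c Hb Hg).
  assert (Hshift : forall n x, Derive_n (Derive g) n x = Derive_n g (S n) x).
  { intros n x; change (Derive g) with (Derive_n g 1).
    rewrite Derive_n_comp, Nat.add_1_r; reflexivity. }
  split; [|split; [|split]].
  - intros s Hs; rewrite Hg by exact Hs.
    assert (0 <= Series (fun n => s / (s + b n))); [|lra].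
    apply Series_nonneg; [|apply ex_series_partial_fractions; assumption].
    intros n; apply Rdiv_le_0_compat; [lra|].
    generalize (proj1 Hb n); lra.
  - intros [|n] x Hx; [exact I|eexists; apply Hd, Hx].
  - intros [|n] x Hx; [exact I|].
    apply (ex_derive_ext (Derive_n g (S n))); [intros; symmetry; apply Hshift|].
    eexists; apply Hd, Hx.
  - intros n x Hx; rewrite Hshift; simpl Derive_n.
    rewrite (is_derive_unique _ _ _ (Hd n x Hx)).
    replace ((-1) ^ n * (2 * ((-1) ^ n * INR (fact (S n)) * stieltjes b (n + 2) x)))
      with (((-1) ^ n * (-1) ^ n) * (2 * (INR (fact (S n)) * stieltjes b (n + 2) x))) by ring.
    rewrite <- Rpow_mult_distr; replace (-1 * -1) with 1 by ring; rewrite pow1, Rmult_1_l.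
    apply Rmult_le_pos; [lra|apply Rmult_le_pos; [apply pos_INR|]].
    apply stieltjes_nonneg; assumption.
Qed.

(* The n-th term of each series involves the (n+1)-st positive zero. *)
Theorem proposition3p1 (nu : R) (hnu : -1 < nu) :
  (forall s : R, 0 < s ->
     (ex_series (fun n : nat => s / (s + bessel_J_zero (nu + 1) (S n) ^ 2)) /\
      G nu s = 2 * (nu + 1)
               + 2 * Series (fun n : nat =>
                       s / (s + bessel_J_zero (nu + 1) (S n) ^ 2))) /\
     (ex_series (fun n : nat =>
        bessel_J_zero (nu + 1) (S n) ^ 2
        / (s + bessel_J_zero (nu + 1) (S n) ^ 2) ^ 2) /\
      is_derive (G nu) s
        (2 * Series (fun n : nat =>
               bessel_J_zero (nu + 1) (S n) ^ 2
               / (s + bessel_J_zero (nu + 1) (S n) ^ 2) ^ 2)))) /\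
  Bernstein (G nu).
Proof.
  assert (Hmu : -1 / 2 <= nu + 1) by lra.
  set (b := fun n => bessel_J_zero (nu + 1) (S n) ^ 2).
  assert (Hbz : forall n, b n = 4 * bfun_zero (nu + 1) n)
    by (intros n; unfold b, bfun_zero; field).
  assert (Hb : summable_inv b).
  { split.
    - intros n; rewrite Hbz; generalize (bfun_zero_gt_0 (nu + 1) n Hmu); lra.
    - apply (ex_series_ext (fun n => / 4 * / bfun_zero (nu + 1) n)).
      + intros n; rewrite Hbz, Rinv_mult; reflexivity.
      + apply (ex_series_scal_l (/ 4) (fun n => / bfun_zero (nu + 1) n)).
        apply ex_series_inv_bfun_zero, Hmu. }
  assert (HG : forall s, 0 < s ->
            G nu s = 2 * (nu + 1) + 2 * Series (fun n => s / (s + b n))).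
  { intros s Hs; rewrite G_bfun by assumption; do 2 f_equal.
    rewrite <- (is_series_unique _ _ (bfun_log_derivative_series (nu + 1) (s / 4) Hmu ltac:(lra))).
    rewrite <- Series_scal_l; apply Series_ext; intros n; rewrite Hbz.
    generalize (bfun_zero_gt_0 (nu + 1) n Hmu); intros Hz; field; lra. }
  split; [|apply (Bernstein_partial_fractions b _ (2 * (nu + 1)) Hb); [lra|exact HG]].
  intros s Hs; split; split.
  - apply (ex_series_partial_fractions b); assumption.
  - apply HG, Hs.
  - apply (ex_series_stieltjes b 0); assumption.
  - assert (H := Derive_n_partial_fractions b _ _ Hb HG 0 s Hs).
    evar_last; [exact H|simpl; unfold stieltjes; rewrite !Rmult_1_l; reflexivity].
Qed.
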